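(* Let $n\in\mathbb{N}$ and let $K_n=\{k\in\mathbb{Z}_n \mid k^2\equiv 1 \pmod n\}$. Then the number of isomorphism classes of bidihedral skew braces of order $2n$ is \[ \mathrm{BD}_n=\begin{cases} |K_n| & \text{if } n\equiv 1,3,5,7 \pmod 8,\\ 2|K_n| & \text{if } n\equiv 2,4,6 \pmod 8,\\ \tfrac52 |K_n| & \text{if } n\equiv 0\pmod 8.\end{cases}\]
   Context: A skew (left) brace is a triple $(G,\cdot,\circ)$ where $G^{\bullet}=(G,\cdot)$ and $G^{\circ}=(G,\circ)$ are groups and $x\circ(y\cdot z)=(x\circ y)\cdot x^{-1}\cdot(x\circ z)$ for all $x,y,z\in G$, where $x^{-1}$ is the inverse of $x$ in $G^{\bullet}$. An isomorphism of skew braces is a bijection respecting both operations. $D_n$ denotes the dihedral group of order $2n$, $D_n=\langle r,s\mid r^n=s^2=e,\ srs^{-1}=r^{-1}\rangle$. A skew brace $(G,\cdot,\circ)$ is called bidihedral (of order $2n$) if $G^{\bullet}\cong G^{\circ}\cong D_n$. $\mathbb{N}$ denotes the positive integers and $\mathbb{Z}_n$ the ring of integers modulo $n$.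
   Formalization: The formal theorem excludes n = 2, where the formula fails: it gives 2|K_2| = 2, but D_2 is the Klein four-group, whose holomorph S_4 has only one regular Klein four-subgroup, so there is exactly one bidihedral skew brace of order 4. *)

(* Defs.v *)
From HB Require Import structures.
From mathcomp Require Import all_boot all_order all_algebra all_fingroup.

Set Implicit Arguments.
Unset Strict Implicit.
Unset Printing Implicit Defensive.

Local Open Scope group_scope.

Reserved Notation "x \o_b y" (at level 40, left associativity).

(* The library group structure of the carrier is the dot group: x * y, x^-1. *)
HB.mixin Record isSkewBrace G of monoid.Group G := {
  circ : G -> G -> G;
  circ_one : G;
  circ_inv : G -> G;
  circA : associative circ;
  circ1g : left_id circ_one circ;
  circg1 : right_id circ_one circ;
  circVg : left_inverse circ_one circ_inv circ;
  circgV : right_inverse circ_one circ_inv circ;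
  circMr : forall x y z : G, circ x (y * z) = circ x y * x^-1 * circ x z
}.

#[short(type="skewBraceType")]
HB.structure Definition SkewBrace := {G of isSkewBrace G & monoid.Group G}.

#[short(type="finSkewBraceType")]
HB.structure Definition FinSkewBrace := {G of SkewBrace G & Finite G}.

Notation "x \o_b y" := (circ x y) : group_scope.

(* Alias of the carrier on which _ * _ denotes the circle operation. *)
Definition circ_group (G : Type) : Type := G.

HB.instance Definition _ (G : skewBraceType) := Choice.on (circ_group G).
HB.instance Definition _ (G : skewBraceType) :=
  isGroup.Build (circ_group G) (@circA G) (@circ1g G) (@circg1 G)
    (@circVg G) (@circgV G).
HB.instance Definition _ (G : finSkewBraceType) :=
  Finite.copy (circ_group G) G.

Definition skew_brace_isomorphic (G H : skewBraceType) : Prop :=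
  exists f : G -> H,
    [/\ bijective f, {morph f : x y / x * y} & {morph f : x y / x \o_b y}].

(* For n > 0 the presented group is finite, so that "\isog Grp" (the largest  *)
(* finite group with this presentation) does mean isomorphic to D_n. The      *)
(* library's 'D_(2 * n) is not used because 'D_2 has order 4.                 *)
Definition dihedral n (gT : finGroupType) : Prop :=
  [set: gT] \isog Grp (r : s : r ^+ n, s ^+ 2, s * r * s^-1 = r^-1).

Definition bidihedral n (G : finSkewBraceType) : Prop :=
  dihedral n G /\ dihedral n (circ_group G).

Definition num_iso_classes (P : finSkewBraceType -> Prop) (N : nat) : Prop :=
  exists B : 'I_N -> finSkewBraceType,
    [/\ forall i, P (B i),
        forall i j, skew_brace_isomorphic (B i) (B j) -> i = j
      & forall G, P G -> exists i, skew_brace_isomorphic G (B i)].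

Definition K n : {set 'I_n} := [set k : 'I_n | (k ^ 2 == 1 %[mod n])%N].

(* Main.v *)
Require Import Defs.
From HB Require Import structures.
From mathcomp Require Import all_boot all_order all_algebra all_fingroup.
From mathcomp Require Import cyclic.
From mathcomp Require Import ring zify.

Set Implicit Arguments.
Unset Strict Implicit.
Unset Printing Implicit Defensive.

(** Fix n >= 3 and write a dihedral group of order 2n as the pairs (i, e) with
i modulo n and e a bit, where (i, e) stands for r^i s^e. In a brace with
such a dot group, left multiplication in the circle group followed by division
in the dot group, y |-> x^-1 (x o y), is an automorphism of the dot group. As
n >= 3, the rotation subgroup C is characteristic, and the automorphism is an
affine map (j, d) |-> (u_x j + d v_x, d), lemma gdih_endo. The brace is thus
the same thing as a pair of functions u, v, and associativity of the circle
operation says that u is a homomorphism and v a crossed homomorphism on the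
circle group, lemma coord_cocycle.

Such a pair is determined by its values on two elements generating the circle
group, lemma rigidity, so everything reduces to normalising generators by the
automorphisms of the dot group. Write a = (1, 0) and b = (0, 1). Since C is
a subgroup of index two of the circle group, there are two cases.
- The circle rotations form C. Then generators rho, sigma of the circle group
  may be moved to a and b. The relations of the dihedral group force
  u_a = p and u_b = k to be square roots of 1, v_b = 0 and v_a = pk - 1, and
  since the circle powers of a exhaust C, 2 is a multiple of 1 + p; hence p = 1
  or, when 8 divides n, p = 1 + n/2 (lemmas classify_cyclic and unit_rot_cases).
- A circle rotation of order n lies outside C, which forces n to be even. It
  may be moved to b, with b o b = a^2 and a a circle reflection. The relations
  give u_a = -1, v_b = -2 and v_a = q - 1, where q = u_b is any square root
  of 1 (lemma classify_dihedral).
Conversely each of these parameters comes from an explicit cocycle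
(family_cocycle), whose circle group is dihedral (dihedral_circ_model).

Automorphisms of the dot group commute on C, so the values of u are invariants
of the brace, and they separate these models except for one coincidence: for
p = 1 + n/2 the generators (a, b) and (a, a o b) give the parameters k and pk
= k + n/2 (model_iso_inv and model_twist). So the first case contributes
|K_n| classes with p = 1 and, when 8 divides n, |K_n|/2 classes with
p = 1 + n/2, and for even n the second case contributes |K_n| more. The order
2n = 2 is treated by hand. *)

Import GRing.Theory.
Local Open Scope group_scope.

(** * Dihedral groups by generators *)

Lemma mem_gen2l (gT : finGroupType) (r s : gT) : r \in <<[set r; s]>>.
Proof. by rewrite mem_gen ?set21. Qed.

Lemma mem_gen2r (gT : finGroupType) (r s : gT) : s \in <<[set r; s]>>.
Proof. by rewrite mem_gen ?set22. Qed.

Definition dihedral_pair n (gT : finGroupType) (r s : gT) :=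
  [/\ r ^+ n = 1, s ^+ 2 = 1 & s * r * s^-1 = r^-1].

Lemma homg_dihedralP n (gT : finGroupType) (H : {group gT}) :
  reflect (exists r s, dihedral_pair n r s /\ <<[set r; s]>> = H)
    (H \homg Grp (r : s : r ^+ n, s ^+ 2, s * r * s^-1 = r^-1)).
Proof.
apply: (iffP existsP) => [[[r s]] | [r [s [[rn s2 srs] defH]]]] /=.
  case/eqP=> defH rn s2 srs; exists r, s; split=> //.
  by rewrite -defH joing_idl joing_idr.
by exists (r, s); rewrite /= rn s2 srs -defH joing_idl joing_idr.
Qed.

Lemma dihedral_pair_gen n (gT : finGroupType) (r s : gT) :
  dihedral_pair n r s -> <<[set r; s]>> = <[r]> * <[s]>.
Proof.
case=> _ _ srs.
have nrs : <[s]> \subset 'N(<[r]>).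
  rewrite cycle_subG -groupV inE -cycleJ cycle_subG /conjg invgK mulgA srs.
  by rewrite groupV cycle_id.
by rewrite -norm_joinEr // joing_idl joing_idr.
Qed.

Lemma card_dihedral_pair_leq n (gT : finGroupType) (r s : gT) :
  (0 < n)%N -> dihedral_pair n r s -> (#|<<[set r; s]>>| <= n * 2)%N.
Proof.
move=> n_gt0 rs; rewrite (dihedral_pair_gen rs); case: rs => rn s2 _.
apply: (@leq_trans (#[r] * #[s])).
  by rewrite mul_cardG leq_pmulr // cardG_gt0.
by apply: leq_mul; apply: dvdn_leq => //; rewrite order_dvdn ?rn ?s2 ?eqxx.
Qed.

(** Freeness of the presentation: given another pair (x, y) satisfying the
relations, the subgroup of the direct product generated by (r, x) and (s, y) has
at most 2n elements, so its projection onto gT is an isomorphism, and its other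
projection yields the required homomorphism. *)
Lemma dihedral_intro n (gT : finGroupType) (r s : gT) :
    (0 < n)%N -> #|gT| = (n * 2)%N ->
    dihedral_pair n r s -> <<[set r; s]>> = [set: gT] ->
  dihedral n gT.
Proof.
move=> n_gt0 cardT rs gen_rs; apply: intro_isoGrp.
  by apply/homg_dihedralP; exists r, s.
move=> rT H /homg_dihedralP[x [y [xy defH]]].
pose P := <<[set (r, x); (s, y)]>>%G.
have pP : dihedral_pair n (r, x) (s, y).
  have expP (a : gT) (b : rT) m : (a, b) ^+ m = (a ^+ m, b ^+ m).
    by elim: m => // m IH; rewrite !expgS IH.
  case: rs => rn s2 srs; case: xy => xn y2 yxy; split.
  - by rewrite expP rn xn.
  - by rewrite expP s2 y2.
  - by congr (_, _).
have imF : fst @* P = [set: gT].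
  by rewrite morphim_gen ?subsetT // morphimEsub ?subsetT // imsetU1 imset_set1.
have imS : snd @* P = H.
  by rewrite morphim_gen ?subsetT // morphimEsub ?subsetT // imsetU1 imset_set1.
have leP : (#|P| <= #|[set: gT]|)%N.
  by rewrite cardsT cardT card_dihedral_pair_leq.
have homP : [set: gT] \homg P by rewrite -imF morphim_homg.
have isoP : [set: gT] \isog P by rewrite isogEcard homP.
apply: (@homg_trans _ P); first by rewrite -imS morphim_homg.
by move: isoP; rewrite isogEhom => /andP[].
Qed.

(** * The generalised dihedral group of an abelian group *)

(** The pair (i, e) stands for r^i s^e; the bit e is true on reflections. A copy
of the product type, because the product already carries another group law. *)
Definition gdih (R : Type) : Type := (R * bool)%type.

Section GDih.
Variable R : finZmodType.
Implicit Types (x y z : gdih R) (a b : R).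

Definition flip (e : bool) a : R := (if e then - a else a)%R.

Definition gdih_mul x y : gdih R := ((x.1 + flip x.2 y.1)%R, x.2 (+) y.2).
Definition gdih_one : gdih R := (0%R, false).
Definition gdih_inv x : gdih R := (flip (~~ x.2) x.1, x.2).

Lemma gdih_mulA : associative gdih_mul.
Proof.
move=> [a e] [b f] [c g]; rewrite /gdih_mul /= addbA; congr (_, _).
by case: e; case: f; rewrite /= ?opprD ?opprK !addrA.
Qed.

Lemma gdih_mul1g : left_id gdih_one gdih_mul.
Proof. by case=> a e; rewrite /gdih_mul /= add0r. Qed.

Lemma gdih_mulg1 : right_id gdih_one gdih_mul.
Proof. by case=> a [] //=; rewrite /gdih_mul /= ?oppr0 addr0. Qed.

Lemma gdih_mulVg : left_inverse gdih_one gdih_inv gdih_mul.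
Proof.
by case=> a [] //=; rewrite /gdih_mul /gdih_inv /= ?subrr ?addNr.
Qed.

Lemma gdih_mulgV : right_inverse gdih_one gdih_inv gdih_mul.
Proof.
by case=> a [] //=; rewrite /gdih_mul /gdih_inv /= ?subrr ?addNr.
Qed.

HB.instance Definition _ := Finite.copy (gdih R) (R * bool)%type.
HB.instance Definition _ := isGroup.Build (gdih R)
  gdih_mulA gdih_mul1g gdih_mulg1 gdih_mulVg gdih_mulgV.

Lemma card_gdih : #|{: gdih R}| = (#|R| * 2)%N.
Proof. by rewrite card_prod card_bool. Qed.

Lemma gdihE x y : x * y = ((x.1 + flip x.2 y.1)%R, x.2 (+) y.2).
Proof. by []. Qed.

Lemma gdih_rotX a m : ((a, false) : gdih R) ^+ m = ((a *+ m)%R, false).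
Proof. by elim: m => // m IH; rewrite expgS IH mulrS. Qed.

Lemma gdih_gen (H : {group gdih R}) a :
    (forall b, exists m, b = (a *+ m)%R) ->
  (a, false) \in H -> (0%R, true) \in H -> H = [set: gdih R] :> {set _}.
Proof.
move=> gen_a Ha Hs; apply/setP=> -[b e]; rewrite inE.
have Hb : (b, false) \in H.
  by have [m ->] := gen_a b; have := groupX m Ha; rewrite gdih_rotX.
case: e => //.
have -> : (b, true) = ((b, false) : gdih R) * ((0%R, true) : gdih R).
  by rewrite gdihE /= addr0.
exact: groupM.
Qed.

End GDih.

Lemma ord_natmul1 n (b : 'I_n.+1) : exists m, b = (inZp 1 *+ m)%R.
Proof.
exists b; apply/val_inj; rewrite Zp_mulrn /= modnMml mul1n.
by rewrite modn_small.
Qed.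

Lemma gdih_pair n :
  dihedral_pair n.+1 ((inZp 1, false) : gdih 'I_n.+1) (0%R, true).
Proof.
split=> //.
- rewrite gdih_rotX; congr (_, _); apply/val_inj.
  by rewrite Zp_mulrn /= modnMl.
- by rewrite expgS expg1 gdihE /= oppr0 addr0.
by rewrite !gdihE /= oppr0 !addr0 add0r.
Qed.

Lemma dihedral_gdih n : dihedral n.+1 (gdih 'I_n.+1).
Proof.
apply: (@dihedral_intro _ (gdih 'I_n.+1) (inZp 1, false) (0%R, true)) => //.
- by rewrite card_gdih card_ord.
- exact: gdih_pair.
apply: (gdih_gen (a := inZp 1)); first exact: ord_natmul1.
  exact: mem_gen2l.
exact: mem_gen2r.
Qed.

(** The relations alone only bound the order by 2n; it is attained because the
concrete dihedral group is a quotient of every group with the universal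
property. *)
Lemma dihedral_elim n (gT : finGroupType) : (0 < n)%N -> dihedral n gT ->
  #|gT| = (n * 2)%N /\
  exists r s : gT, dihedral_pair n r s /\ <<[set r; s]>> = [set: gT].
Proof.
case: n => // n _ dT.
have /homg_dihedralP[r [s [rs gen_rs]]] := isoGrp_hom dT.
split; last by exists r, s.
apply/eqP; rewrite eqn_leq -cardsT -gen_rs card_dihedral_pair_leq // gen_rs.
have: [set: gdih 'I_n.+1] \homg [set: gT].
  by rewrite dT; exact: (isoGrp_hom (dihedral_gdih n)).
by move/leq_homg; rewrite cardsT card_gdih card_ord.
Qed.

(** * Skew braces on a generalised dihedral group *)

Section Affine.
Variable R : finComNzRingType.
Implicit Types (x y z : gdih R) (a b u v : R).

(** For R the integers modulo n >= 3 and u a unit, these maps are the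
automorphisms of the dihedral group. *)
Definition affine u v y : gdih R :=
  ((u * y.1 + (if y.2 then v else 0))%R, y.2).

Definition affine_circ (u v : gdih R -> R) x y : gdih R :=
  x * affine (u x) (v x) y.

Lemma affineM u v : {morph affine u v : y z / y * z}.
Proof.
move=> [b e] [c f]; rewrite /affine !gdihE /=; congr (_, _).
by case: e; case: f => /=; ring.
Qed.

Lemma affine_comp u v u' v' y :
  affine u v (affine u' v' y) = affine (u * u')%R (v + u * v')%R y.
Proof.
case: y => b e; rewrite /affine /=; congr (_, _).
by case: e => /=; ring.
Qed.

Lemma affine1 y : affine 1%R 0%R y = y.
Proof. by case: y => b e; rewrite /affine /= mul1r if_same addr0. Qed.

(** The equations say that x |-> affine (u x) (v x) is a homomorphism from the
circle group, which is what makes the circle operation associative. Asking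
u to have square one costs no generality for dihedral circle groups, whose
abelianisation has exponent two. *)
Record cocycle := Cocycle {
  cocycle_unit : gdih R -> R;
  cocycle_shift : gdih R -> R;
  cocycle_sqr : forall x, (cocycle_unit x * cocycle_unit x = 1)%R;
  cocycle_unitM : forall x y,
    (cocycle_unit (affine_circ cocycle_unit cocycle_shift x y)
      = cocycle_unit x * cocycle_unit y)%R;
  cocycle_shiftM : forall x y,
    (cocycle_shift (affine_circ cocycle_unit cocycle_shift x y)
      = cocycle_shift x + cocycle_unit x * cocycle_shift y)%R
}.

Variable c : cocycle.
Local Notation u := (cocycle_unit c).
Local Notation v := (cocycle_shift c).
Local Notation circ_uv := (affine_circ u v).

Lemma affine_gdih1 a b : affine a b 1 = 1.
Proof. by rewrite /affine /= mulr0 addr0. Qed.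

Lemma affine_circ1 x : circ_uv x 1 = x.
Proof. by rewrite /affine_circ affine_gdih1 mulg1. Qed.

Lemma cocycle_unit1 : u 1 = 1%R.
Proof. by have := cocycle_unitM c 1 1; rewrite affine_circ1 cocycle_sqr. Qed.

Lemma cocycle_shift1 : v 1 = 0%R.
Proof.
have /eqP := cocycle_shiftM c 1 1.
by rewrite affine_circ1 cocycle_unit1 mul1r -subr_eq subrr eq_sym => /eqP.
Qed.

Lemma affine_1circ x : circ_uv 1 x = x.
Proof. by rewrite /affine_circ cocycle_unit1 cocycle_shift1 affine1 mul1g. Qed.

Lemma affine_circA : associative circ_uv.
Proof.
move=> x y z; rewrite [RHS]/affine_circ cocycle_unitM cocycle_shiftM.
by rewrite -affine_comp /affine_circ affineM mulgA.
Qed.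

Definition affine_inv x : gdih R := affine (u x) (- (u x * v x))%R x^-1.

Lemma affine_circV : right_inverse 1 affine_inv circ_uv.
Proof.
move=> x; rewrite /affine_circ /affine_inv affine_comp cocycle_sqr.
by rewrite mulrN mulrA cocycle_sqr mul1r subrr affine1 mulgV.
Qed.

Lemma affine_Vcirc : left_inverse 1 affine_inv circ_uv.
Proof.
move=> x; rewrite -[LHS]affine_circ1 -(affine_circV (affine_inv x)).
by rewrite affine_circA -(affine_circA _ x) affine_circV affine_circ1.
Qed.

Lemma affine_circMr x y z :
  circ_uv x (y * z) = circ_uv x y * x^-1 * circ_uv x z.
Proof. by rewrite /affine_circ affineM !mulgA mulgKV. Qed.

End Affine.

Definition cocycle_brace (R : finComNzRingType) (c : cocycle R) : Type :=
  gdih R.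

Section CocycleBrace.
Variables (R : finComNzRingType) (c : cocycle R).

HB.instance Definition _ := FinGroup.copy (cocycle_brace c) (gdih R).
HB.instance Definition _ := isSkewBrace.Build (cocycle_brace c)
  (@affine_circA R c) (@affine_1circ R c) (@affine_circ1 R c)
  (@affine_Vcirc R c) (@affine_circV R c) (@affine_circMr R c).

End CocycleBrace.

Definition trivial_brace (gT : Type) : Type := gT.
Section TrivialBrace.
Variable gT : finGroupType.

Lemma trivial_circMr (x y z : gT) : x * (y * z) = x * y * x^-1 * (x * z).
Proof. by rewrite !mulgA mulgKV. Qed.

HB.instance Definition _ := FinGroup.copy (trivial_brace gT) gT.
HB.instance Definition _ := isSkewBrace.Build (trivial_brace gT)
  (@mulgA gT) (@mul1g gT) (@mulg1 gT) (@mulVg gT) (@mulgV gT) trivial_circMr.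
End TrivialBrace.

(** * The explicit cocycles *)

Section Family.
Variables (R : finComNzRingType) (par : R -> bool).
Hypothesis parD : forall a b, par (a + b)%R = par a (+) par b.
Hypothesis par_unit : forall c a, (c * c = 1)%R -> par (c * a)%R = par a.
Variables (p k : R) (t : bool).
Hypotheses (p2 : (p * p = 1)%R) (k2 : (k * k = 1)%R) (tp : t -> (p = -1)%R).
Implicit Types x y : gdih R.

(** These formulas come from writing an arbitrary element as a circle word in
a = (1, 0) and b = (0, 1) and multiplying out from u a = p, u b = k. The predicate
par is the residue modulo two when it exists, and false otherwise. With t false
the circle rotations are the dot rotations; the correction term with t true
makes b a circle rotation. *)
Definition family_unit x : R :=
  ((if par x.1 then p else 1) * (if x.2 then k else 1))%R.

Definition family_shift x : R :=
  (flip x.2 ((p * k - 1) * x.1)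
   + (if t && (par x.1 (+) x.2) then (if x.2 then - 2%:R else 2%:R * k)
      else 0))%R.

Local Notation u := family_unit.
Local Notation v := family_shift.

Lemma family_sqr x : (u x * u x = 1)%R.
Proof. by rewrite /u; case: ifP => _; case: ifP => _; ring: p2 k2. Qed.

Lemma par0 : par 0%R = false.
Proof. by have := parD 0%R 0%R; rewrite addbb addr0. Qed.

Lemma parN a : par (- a)%R = par a.
Proof.
have := parD a (- a)%R; rewrite subrr par0.
by case: (par a); case: (par _).
Qed.

Lemma par_flip e a : par (flip e a) = par a.
Proof. by case: e; rewrite /flip ?parN. Qed.

Lemma par_double a : par (2%:R * a)%R = false.
Proof. by rewrite mulr_natl mulr2n parD addbb. Qed.

(** Hence the first coordinate has additive parity under the circle operation
too, which is why the unit may depend on that parity. *)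
Lemma par_shift x : par (v x) = false.
Proof.
rewrite /v parD par_flip mulrBl parD mul1r parN par_unit ?addbb; last first.
  by ring: p2 k2.
case: ifP => // _; last exact: par0.
by case: x.2; rewrite ?par_double // parN -[2%:R%R]mulr1 par_double.
Qed.

Lemma par_circ x y : par (affine_circ u v x y).1 = par x.1 (+) par y.1.
Proof.
rewrite /affine_circ gdihE /affine /= parD par_flip parD par_unit.
  by case: y.2; rewrite ?par_shift ?par0 addbF.
exact: family_sqr.
Qed.

Lemma family_unitM x y : (u (affine_circ u v x y) = u x * u y)%R.
Proof.
rewrite {1}/u par_circ /affine_circ gdihE /u /=.
by case: (par x.1); case: (par y.1); case: x.2; case: y.2 => /=; ring: p2 k2.
Qed.

Lemma family_shiftM x y : (v (affine_circ u v x y) = v x + u x * v y)%R.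
Proof.
rewrite {1}/v par_circ /affine_circ gdihE /= /u /v /flip.
case: x y => a e [b f] /=.
case: (boolP t) => [/tp p1|_] /=; last first.
  case: (par a); case: (par b); case: e; case: f => /=; ring: p2 k2.
rewrite p1.
by case: (par a); case: (par b); case: e; case: f => /=; ring: k2.
Qed.

Definition family_cocycle : cocycle R :=
  Cocycle family_sqr family_unitM family_shiftM.

End Family.

(** * The models *)

Section Models.
Variable m : nat.
Local Notation n := m.+3.
Local Notation R := 'I_m.+3.

(** Constantly false for n odd, so that it is additive for every n. *)
Definition zpar (a : R) : bool := ~~ odd n && odd a.

Lemma zparD a b : zpar (a + b)%R = zpar a (+) zpar b.
Proof.
rewrite /zpar; have [_|odn] := boolP (odd n); first by [].
by rewrite /= -[RHS]oddD -[RHS](@odd_mod _ n) //; apply: negbTE.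
Qed.

Lemma zpar_unit (c a : R) : (c * c = 1)%R -> zpar (c * a)%R = zpar a.
Proof.
rewrite /zpar => /(congr1 val) cc; have [_|odn] := boolP (odd n); first by [].
have odmod x : odd (x %% n) = odd x by rewrite odd_mod //; apply: negbTE.
suff oddc : odd c by rewrite -[in LHS]/(val _) odmod oddM oddc.
by rewrite -(andbb (odd c)) -oddM -odmod [(_ %% _)%N]cc.
Qed.

Lemma zpar1 : zpar 1%R = ~~ odd n.
Proof. by rewrite /zpar andbT. Qed.

Lemma zparE (a : R) : ~~ odd n -> zpar a = odd a.
Proof. by rewrite /zpar => ->. Qed.

Lemma zmod_half (a : R) : exists i : R, a = (2%:R * i + (odd a)%:R)%R.
Proof.
exists ((a./2)%:R)%R; rewrite -natrM -natrD mul2n addnC odd_double_half.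
by rewrite natr_Zp.
Qed.

Lemma natr_n0 : (n%:R = 0 :> R)%R.
Proof. exact: (@pchar_Zp n isT). Qed.

(** The parameters of the bidihedral cocycles. The condition rot_unit_gen says
that the circle powers of (1, 0) exhaust the dot rotations: the even ones among
them are the multiples of 1 + rot_unit. *)
Record datum := Datum {
  interchanged : bool;
  rot_unit : R;
  refl_unit : R;
  rot_unit_sqr : (rot_unit * rot_unit = 1)%R;
  refl_unit_sqr : (refl_unit * refl_unit = 1)%R;
  interchanged_rot_unit : interchanged -> (rot_unit = -1)%R;
  rot_unit_odd : odd n -> (rot_unit = 1)%R;
  interchanged_even : interchanged -> ~~ odd n;
  rot_unit_gen : ~~ interchanged -> exists j : R, (j * (1 + rot_unit) = 2%:R)%R
}.

Variable D : datum.
Local Notation p := (rot_unit D).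
Local Notation k := (refl_unit D).
Local Notation t := (interchanged D).

(** Locked, so that simplification does not unfold the formulas and the values on
the two generators can be rewritten instead. *)
Definition datum_cocycle : cocycle R :=
  locked (family_cocycle zparD zpar_unit (rot_unit_sqr D) (refl_unit_sqr D)
            (@interchanged_rot_unit D)).

Lemma datum_unitE x : cocycle_unit datum_cocycle x = family_unit zpar p k x.
Proof. by rewrite /datum_cocycle -lock. Qed.

Lemma datum_shiftE x :
  cocycle_shift datum_cocycle x = family_shift zpar p k t x.
Proof. by rewrite /datum_cocycle -lock. Qed.

Definition model := cocycle_brace datum_cocycle.

Local Notation u := (cocycle_unit datum_cocycle).
Local Notation v := (cocycle_shift datum_cocycle).

Lemma datum_unit_rot : u (1%R, false) = p.
Proof.
rewrite datum_unitE /family_unit /= zpar1 mulr1.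
case: (boolP (odd n)) => //= odn.
by rewrite rot_unit_odd.
Qed.

Lemma datum_shift_rot :
  v (1%R, false) = (p * k - 1 + if t then 2%:R * k else 0)%R.
Proof.
rewrite datum_shiftE /family_shift /= zpar1 mulr1 addbF.
by case: (boolP t) => //= /interchanged_even ->.
Qed.

Lemma zpar0 : zpar 0%R = false.
Proof. by rewrite /zpar /= andbF. Qed.

Lemma datum_unit_refl : u (0%R, true) = k.
Proof. by rewrite datum_unitE /family_unit /= zpar0 mul1r. Qed.

Lemma datum_shift_refl : v (0%R, true) = (if t then - 2%:R else 0)%R.
Proof.
by rewrite datum_shiftE /family_shift /= zpar0 mulr0 oppr0 add0r andbT.
Qed.

End Models.


(** * The models are bidihedral *)

Lemma mulg_invol_swap (gT : finGroupType) (x y : gT) :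
  x * y * (x * y) = 1 -> y * x * (y * x) = 1.
Proof.
by move=> xy; apply: (mulgI x); rewrite mulg1 !mulgA -(mulgA (x * y)) xy mul1g.
Qed.

Lemma dihedral_pair_intro n (gT : finGroupType) (r s : gT) :
  r ^+ n = 1 -> s * s = 1 -> s * r * (s * r) = 1 -> dihedral_pair n r s.
Proof.
move=> rn s2 sr2; split=> //.
have -> : s^-1 = s by apply/eqP; rewrite eq_invg_mul s2.
by apply: (mulIg r); rewrite mulVg -sr2 !mulgA.
Qed.

Section CocycleCirc.
Variables (R : finComNzRingType) (c : cocycle R).
Local Notation u := (cocycle_unit c).
Local Notation v := (cocycle_shift c).
Local Notation cG := (circ_group (cocycle_brace c)).

Lemma cocycle_circE (x y : cG) :
  x * y = ((x.1 + flip x.2 (u x * y.1 + (if y.2 then v x else 0)))%R,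
           x.2 (+) y.2).
Proof. by []. Qed.

Lemma cocycle_rotX z j : u (z, false) = 1%R ->
  ((z, false) : cG) ^+ j = ((z *+ j)%R, false).
Proof.
move=> uz; elim: j => // j IH.
by rewrite expgS IH cocycle_circE /= uz mul1r addr0 mulrS.
Qed.

Lemma cocycle_circ_gen (H : {group cG}) :
    (forall z, ((z, false) : cG) \in H) -> ((0%R, true) : cG) \in H ->
  H = [set: cG] :> {set _}.
Proof.
move=> Hrot Hrefl; apply/setP=> x; rewrite inE.
case: x => a []; last exact: Hrot.
rewrite -(groupMr ((a, true) : cG) Hrefl).
have -> : ((a, true) : cG) * ((0%R, true) : cG)
  = ((a - v (a, true))%R, false) :> cG.
  by rewrite cocycle_circE /= mulr0 add0r.
exact: Hrot.
Qed.

End CocycleCirc.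

Section ModelDihedral.
Variable m : nat.
Local Notation n := m.+3.
Local Notation R := 'I_m.+3.
Variable D : datum m.
Local Notation p := (rot_unit D).
Local Notation k := (refl_unit D).
Local Notation t := (interchanged D).
Local Notation u := (cocycle_unit (datum_cocycle D)).
Local Notation v := (cocycle_shift (datum_cocycle D)).
Local Notation cG := (circ_group (model D)).
Local Notation a := ((1%R, false) : cG).
Local Notation b := ((0%R, true) : cG).

Lemma dihedral_model : dihedral n (model D).
Proof. exact: dihedral_gdih. Qed.

(** Circle multiplication by (1, 0) carries even dot rotations to odd ones. *)
Lemma model_circ_gen (H : {group cG}) :
    a \in H -> b \in H -> (forall i : R, (((2%:R * i)%R, false) : cG) \in H) ->
  H = [set: cG] :> {set _}.
Proof.
move=> Ha Hb Hdouble; apply: cocycle_circ_gen => // z.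
have [i ->] := zmod_half z; case: (odd z); rewrite ?addr0 //.
suff <- : a * (((2%:R * (p * i))%R, false) : cG)
  = ((2%:R * i + 1)%R, false) :> cG by rewrite groupM.
rewrite cocycle_circE datum_unit_rot /=; congr (_, _).
by ring: (rot_unit_sqr D).
Qed.

Lemma model_aa : a * a = ((1 + p)%R, false) :> cG.
Proof. by rewrite cocycle_circE datum_unit_rot /= mulr1 addr0. Qed.

Lemma model_bb : b * b = ((if t then 2%:R else 0)%R, false) :> cG.
Proof.
rewrite cocycle_circE datum_shift_refl /= mulr0 !add0r.
by case: t; rewrite ?opprK ?oppr0.
Qed.

Lemma model_unit_aa : u (1 + p, false)%R = 1%R.
Proof.
rewrite -[(_, _)]/(((1 + p)%R, false) : cG) -model_aa.
by rewrite [LHS]cocycle_unitM cocycle_sqr.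
Qed.

Lemma model_unit_double i : u ((2%:R * i)%R, false) = 1%R.
Proof.
by rewrite datum_unitE /family_unit /= mulr_natl mulr2n zparD addbb mulr1.
Qed.

Lemma natr_half (z : R) : ~~ odd n -> (exists i, z = 2%:R * i)%R ->
  (z *+ n./2 = 0)%R.
Proof.
move=> odn [i ->]; rewrite mulr_natl -mulrnA mul2n.
have -> : n./2.*2 = n by rewrite -[RHS]odd_double_half (negbTE odn).
by rewrite -mulr_natr natr_n0 mulr0.
Qed.

Lemma model_abab : (a * b) * (a * b) = 1 :> cG.
Proof.
have uab : u (a * b) = (p * k)%R.
  by rewrite [LHS]cocycle_unitM datum_unit_rot datum_unit_refl.
have vab : v (a * b) = (v (1%R, false) + p * v (0%R, true))%R.
  by rewrite [LHS]cocycle_shiftM datum_unit_rot.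
rewrite cocycle_circE uab vab datum_shift_rot datum_shift_refl.
rewrite !cocycle_circE /=.
rewrite /= datum_unit_rot datum_shift_rot.
rewrite mulr0 add0r.
apply: (congr1 (fun z : R => (z, false) : cG) (y := 0%R)).
have := rot_unit_sqr D; have := refl_unit_sqr D.
case: (boolP t) => [/interchanged_rot_unit ->|_] kk pp.
  by ring: kk.
by ring: kk pp.
Qed.

(** The circle rotation of order n is a in the cyclic family and b in the
interchanged one. Its even circle powers are multiples of its circle square,
which acts with unit 1, so they are computed additively. *)
Lemma dihedral_circ_model : dihedral n cG.
Proof.
have cardG : #|{: cG}| = (n * 2)%N by rewrite card_gdih card_ord.
have [dtD|dtD] := boolP t.
  have odn := interchanged_even dtD; have pE := interchanged_rot_unit dtD.
  have bb : b * b = (2%:R%R, false) by rewrite model_bb dtD.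
  have bX i : (b ^+ (2 * i)) = ((2%:R *+ i)%R, false).
    rewrite expgM expgS expg1 bb cocycle_rotX //.
    by rewrite -[2%:R%R]mulr1 model_unit_double.
  apply: (@dihedral_intro _ cG b a) => //.
    apply: dihedral_pair_intro.
    - have -> : n = (2 * n./2)%N.
        by rewrite mul2n -[LHS]odd_double_half (negbTE odn).
      rewrite bX natr_half //.
      by exists 1%R; rewrite mulr1.
    - by rewrite model_aa pE subrr.
    - exact: model_abab.
  apply: model_circ_gen; [exact: mem_gen2r | exact: mem_gen2l | move=> i].
  have := groupX (2 * i) (mem_gen2l b a).
  by rewrite bX -[in X in _ -> X](natr_Zp i) mulr_natr.
have [j jE] := rot_unit_gen dtD.
have aaX i : a ^+ (2 * i) = (((1 + p) *+ i)%R, false).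
  by rewrite expgM expgS expg1 model_aa cocycle_rotX ?model_unit_aa.
apply: (@dihedral_intro _ cG a b) => //.
  apply: dihedral_pair_intro.
  - have [odn|odn] := boolP (odd n).
      have := cocycle_rotX (c := datum_cocycle D) (z := 1%R) n.
      by rewrite datum_unit_rot natr_n0; apply; apply: rot_unit_odd.
    have -> : n = (2 * n./2)%N.
      by rewrite mul2n -[LHS]odd_double_half (negbTE odn).
    rewrite aaX natr_half //.
    have [i pE] := zmod_half p.
    have oddp : odd p.
      by rewrite -zparE // -[p]mulr1 zpar_unit ?zpar1 //; apply: rot_unit_sqr.
    by exists (1 + i)%R; rewrite {1}pE oddp /=; ring.
  - by rewrite model_bb (negbTE dtD).
  - exact: (mulg_invol_swap model_abab).
apply: model_circ_gen; [exact: mem_gen2l | exact: mem_gen2r | move=> i].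
have := groupX (2 * (j * i)%R) (mem_gen2l a b).
rewrite aaX -mulr_natr natr_Zp (_ : (1 + p) * _ = 2%:R * i)%R //.
by rewrite mulrA [((1 + p) * j)%R]mulrC jE.
Qed.
End ModelDihedral.

(** * Coordinates on a bidihedral brace *)

(** Used for both group laws of a brace: the circle law gives a second
identification of the carrier with the concrete dihedral group. *)
Lemma dihedral_coord m (gT : finGroupType) (r s : gT) :
    dihedral_pair m.+3 r s -> <<[set r; s]>> = [set: gT] ->
    #|gT| = (m.+3 * 2)%N ->
  exists phi : gdih 'I_m.+3 -> gT,
    [/\ bijective phi, {morph phi : x y / x * y},
        phi (1%R, false) = r & phi (0%R, true) = s].
Proof.
move=> rs gen_rs cardT; have [rn s2 srs] := rs.
have rX i : r ^+ (i %% m.+3) = r ^+ i by rewrite expg_mod.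
have rV (i : 'I_m.+3) : r ^+ (- i)%R = r ^- i.
  apply/eqP; rewrite eq_sym eq_invg_mul /= rX -expgD subnKC ?rn //.
  exact: ltnW.
have sr i : s * r ^+ i = r ^- i * s.
  apply: (mulIg s^-1); rewrite mulgK -expgVn -srs.
  have conj x : s * x * s^-1 = x ^ s^-1 by rewrite conjgE invgK mulgA.
  by rewrite !conj conjXg.
pose phi (x : gdih 'I_m.+3) := r ^+ x.1 * s ^+ x.2.
have phiM : {morph phi : x y / x * y}.
  move=> [i e] [j f]; rewrite gdihE /phi /= rX expgD.
  case: e => /=; last by rewrite mulg1 mulgA.
  rewrite expg1 -[RHS]mulgA [s * _]mulgA sr rV -!mulgA.
  congr (_ * (_ * _)); case: f; last by rewrite mulg1.
  exact: esym s2.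
have phir : phi (1%R, false) = r by rewrite /phi /= mulg1 expg1.
have phis : phi (0%R, true) = s by rewrite /phi /= mul1g expg1.
exists phi; split=> //.
suff im : phi @: [set: gdih 'I_m.+3] = [set: gT].
  apply: inj_card_bij; last by rewrite cardT card_gdih card_ord.
  have /imset_injP inj_phi :
      #|phi @: [set: gdih 'I_m.+3]| == #|[set: gdih 'I_m.+3]|.
    by rewrite im !cardsT cardT card_gdih card_ord.
  by move=> x y; apply: inj_phi; rewrite in_setT.
apply/eqP; rewrite eqEsubset subsetT -gen_rs (dihedral_pair_gen rs).
apply/subsetP => _ /mulsgP[_ _ /cycleP[i ->] /cycleP[j ->] ->].
have phiX x k : phi x ^+ k = phi (x ^+ k).
  by elim: k => [|k IH]; [rewrite /phi /= mulg1 | rewrite !expgS IH phiM].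
by rewrite -phir -phis !phiX -phiM imset_f ?inE.
Qed.

Lemma affine_inj (R : finComNzRingType) (a b a' b' : R) :
  affine a b =1 affine a' b' -> a = a' /\ b = b'.
Proof.
move=> e; have /(congr1 fst) := e (1%R, false).
have /(congr1 fst) := e (0%R, true).
by rewrite /= !mulr0 !mulr1 !addr0 !add0r.
Qed.

Section GDihEndo.
Variable m : nat.
Local Notation R := 'I_m.+3.
Implicit Types (x y : gdih R) (L : gdih R -> gdih R).

Lemma two_neq0 : (2%:R : R)%R != 0%R.
Proof. by rewrite Zp_nat -val_eqE. Qed.

Lemma gdih_natX (i : R) : ((i, false) : gdih R) = ((1%R, false) : gdih R) ^+ i.
Proof. by rewrite gdih_rotX natr_Zp. Qed.

(** Reflections are involutions while (1, 0) is not, as n >= 3; so L preserves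
rotations. It cannot send (0, 1) to a rotation, because (0, 1) does not commute
with (1, 0). *)
Lemma gdih_endo L : injective L -> {morph L : x y / x * y} ->
  L =1 affine (L (1%R, false)).1 (L (0%R, true)).1.
Proof.
move=> injL LM.
have L1 : L 1 = 1 by apply: (mulgI (L 1)); rewrite -LM !mulg1.
have LX x i : L (x ^+ i) = L x ^+ i.
  by elim: i => // i IH; rewrite !expgS LM IH.
have La : (L (1%R, false)).2 = false.
  case: (boolP (_.2)) => // La.
  have : L ((2%:R)%R, false) = L 1.
    have -> : ((2%:R)%R, false) = ((1%R, false) : gdih R) ^+ 2 by [].
    rewrite LX L1; move: La; case: (L _) => c [] //= _.
    by rewrite expgS expg1 gdihE /= subrr.
  by move/injL/(congr1 fst)/eqP; rewrite (negPf two_neq0).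
have Lb : (L (0%R, true)).2 = true.
  case: (boolP (_.2)) => // Lb.
  have : L (((0%R, true) : gdih R) * (1%R, false))
         = L (((1%R, false) : gdih R) * (0%R, true)).
    rewrite !LM; move: La Lb; case: (L _) => c [] //= _; case: (L _) => d [] //=.
    by rewrite !gdihE /= addrC.
  move/injL/(congr1 fst)/eqP; rewrite !gdihE /= add0r addr0.
  by rewrite eq_sym -subr_eq0 opprK (negPf two_neq0).
move=> [i e].
have Li : L (i, false) = ((L (1%R, false)).1 * i, false)%R.
  rewrite gdih_natX LX; move: La; case: (L _) => c [] //= _.
  by rewrite gdih_rotX -mulr_natr natr_Zp.
case: e; last by rewrite Li /affine /= addr0.
have -> : (i, true) = ((i, false) : gdih R) * ((0%R, true) : gdih R).
  by rewrite gdihE /= addr0.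
rewrite LM Li; move: Lb; case: (L (0%R, true)) => d [] //= _.
by rewrite gdihE /affine /= addr0.
Qed.

End GDihEndo.

Lemma circ_one1 (G : skewBraceType) : circ_one = 1 :> G.
Proof.
have e : (1 : G) \o_b 1 = 1.
  have := circMr (1 : G) 1 1; rewrite mulg1 invg1 mulg1 => /eqP.
  by rewrite -{1}[X in X == _]mulg1 (inj_eq (mulgI _)) eq_sym => /eqP.
by have := circA (circ_inv 1) (1 : G) 1; rewrite e circVg circ1g.
Qed.

Section Coordinates.
Variable m : nat.
Local Notation n := m.+3.
Local Notation R := 'I_m.+3.
Variable G : finSkewBraceType.
Implicit Types (x y z : gdih R).

(** An identification of the dot group with the concrete dihedral group, under
which the circle law is the one built from u and v. *)
Record coordinates (phi : gdih R -> G) (u v : gdih R -> R) : Prop := {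
  coord_bij : bijective phi;
  coordM : {morph phi : x y / x * y};
  coord_circ : forall x y, phi (affine_circ u v x y) = phi x \o_b phi y
}.

Lemma coordinates_exist (phi : gdih R -> G) :
    bijective phi -> {morph phi : x y / x * y} ->
  exists u v, coordinates phi u v.
Proof.
move=> bij_phi phiM; have [psi phiK psiK] := bij_phi.
pose lam (g h : G) := g^-1 * (g \o_b h).
pose L x y := psi (lam (phi x) (phi y)).
have psiM : {morph psi : g h / g * h}.
  by move=> g h; apply: (can_inj phiK); rewrite phiM !psiK.
have lamM g : {morph lam g : h k / h * k}.
  by move=> h k; rewrite /lam circMr !mulgA.
have inj_lam g : injective (lam g).
  move=> h k /mulgI /(congr1 (circ (circ_inv g))).
  by rewrite !circA circVg !circ1g.
have injL x : injective (L x).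
  by move=> y z /(can_inj psiK) /inj_lam /(can_inj phiK).
have LM x : {morph L x : y z / y * z}.
  by move=> y z; rewrite /L phiM lamM psiM.
exists (fun x => (L x (1%R, false)).1), (fun x => (L x (0%R, true)).1).
split=> // x y; rewrite /affine_circ -(gdih_endo (@injL x) (@LM x)).
by rewrite phiM psiK mulVKg.
Qed.

Variables (phi : gdih R -> G) (u v : gdih R -> R).
Hypothesis Co : coordinates phi u v.
Local Notation circ_uv := (affine_circ u v).

Let phi_inj : injective phi := bij_inj (coord_bij Co).

Lemma coord_circA : associative circ_uv.
Proof. by move=> x y z; apply: phi_inj; rewrite !(coord_circ Co) circA. Qed.

Lemma coord_cocycle x y :
  u (circ_uv x y) = (u x * u y)%R /\ v (circ_uv x y) = (v x + u x * v y)%R.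
Proof.
have e z : affine (u (circ_uv x y)) (v (circ_uv x y)) z
           = affine (u x * u y)%R (v x + u x * v y)%R z.
  have := coord_circA x y z; rewrite {4}/affine_circ /= [RHS]/affine_circ.
  rewrite /affine_circ affineM -affine_comp !mulgA.
  by move/mulgI.
exact: affine_inj e.
Qed.

Lemma coord_phi1 : phi 1 = 1.
Proof. by apply: (mulgI (phi 1)); rewrite -(coordM Co) !mulg1. Qed.

Lemma coord_1circ x : circ_uv 1 x = x.
Proof.
by apply: phi_inj; rewrite (coord_circ Co) coord_phi1 -circ_one1 circ1g.
Qed.

Lemma coord_affine1 : affine (u 1) (v 1) =1 affine 1%R 0%R.
Proof.
by move=> x; rewrite affine1; have := coord_1circ x; rewrite /affine_circ mul1g.
Qed.

Lemma coord_unit1 : u 1 = 1%R.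
Proof. by have [] := affine_inj coord_affine1. Qed.

Lemma coord_shift1 : v 1 = 0%R.
Proof. by have [] := affine_inj coord_affine1. Qed.

(** Precomposing with an automorphism of the dihedral group, which is how the
generators are normalised. *)
Lemma coord_change (a a' b : R) : (a * a' = 1)%R ->
  exists u' v', coordinates (phi \o affine a b) u' v'.
Proof.
move=> aa'; exists (fun x => u (affine a b x)).
exists (fun x => (a' * (v (affine a b x) + (u (affine a b x) - 1) * b))%R).
split=> [||x y].
- apply: bij_comp (coord_bij Co) _; exists (affine a' (- (a' * b))%R) => x.
    by rewrite affine_comp mulrC aa' addrC subrr affine1.
  by rewrite affine_comp aa' mulrN mulrA aa' mul1r subrr affine1.
- by move=> x y; rewrite /= affineM (coordM Co).
rewrite /= -(coord_circ Co) /affine_circ affineM !affine_comp.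
congr (phi (_ * affine _ _ _)); first exact: mulrC.
by rewrite mulrA aa'; ring.
Qed.

End Coordinates.

(** * A brace is determined by its cocycle on generators *)

Lemma gdih_gen_ord m (H : {group gdih 'I_m.+3}) (i : 'I_m.+3) :
  ((1%R, false) : gdih 'I_m.+3) \in H -> ((i, true) : gdih 'I_m.+3) \in H ->
  H = [set: gdih 'I_m.+3] :> {set _}.
Proof.
move=> Ha Hi; apply: (gdih_gen (a := 1%R)) => //.
  by move=> b; exists b; rewrite natr_Zp.
have Hx : ((i, false) : gdih 'I_m.+3) \in H by rewrite gdih_natX groupX.
have := groupM (groupVr Hx) Hi.
by rewrite gdihE /= addNr.
Qed.

Section Rigidity.
Variable m : nat.
Local Notation n := m.+3.
Local Notation R := 'I_m.+3.
Local Notation a := ((1%R, false) : gdih R).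
Local Notation b := ((0%R, true) : gdih R).
Variables (G : finSkewBraceType) (phi : gdih R -> G) (u v : gdih R -> R).
Hypothesis Co : coordinates phi u v.
Variable theta : gdih R -> gdih R.
Hypotheses (theta_bij : bijective theta)
  (thetaM : forall x y, theta (x * y) = affine_circ u v (theta x) (theta y)).

Lemma theta1 : theta 1 = 1.
Proof.
have [eta thetaK etaK] := theta_bij.
have /(congr1 theta) : eta 1 * 1 = eta 1 by rewrite mulg1.
by rewrite thetaM etaK (coord_1circ Co).
Qed.

(** Two crossed homomorphisms that agree at two elements agree on the circle
subgroup they generate. The map theta reads the circle group in dot coordinates,
so this subgroup is pulled back to a subgroup of the concrete dihedral group. *)
Lemma rigidity (D : datum m) x y :
    (forall H : {group gdih R}, x \in H -> y \in H ->
       H = [set: gdih R] :> {set _}) ->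
    theta x = a -> theta y = b ->
    u a = cocycle_unit (datum_cocycle D) a ->
    v a = cocycle_shift (datum_cocycle D) a ->
    u b = cocycle_unit (datum_cocycle D) b ->
    v b = cocycle_shift (datum_cocycle D) b ->
  skew_brace_isomorphic G (model D).
Proof.
set c := datum_cocycle D => gen tx ty ua va ub vb.
pose E := [set z : gdih R | (u (theta z) == cocycle_unit c (theta z))
                   && (v (theta z) == cocycle_shift c (theta z))].
have groupE : group_set E.
  apply/group_setP; split.
    rewrite inE theta1 (coord_unit1 Co) (coord_shift1 Co).
    by rewrite cocycle_unit1 cocycle_shift1 !eqxx.
  move=> z w; rewrite !inE => /andP[/eqP uz /eqP vz] /andP[/eqP uw /eqP vw].
  rewrite thetaM; have [-> ->] := coord_cocycle Co (theta z) (theta w).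
  have -> : affine_circ u v (theta z) (theta w)
            = affine_circ (cocycle_unit c) (cocycle_shift c)
                (theta z) (theta w).
    by rewrite /affine_circ uz vz.
  by rewrite cocycle_unitM cocycle_shiftM uz uw vz vw !eqxx.
have ET : E = [set: gdih R].
  by apply: (gen (group groupE)); rewrite inE ?tx ?ty ?ua ?va ?ub ?vb !eqxx.
have uv z : u z = cocycle_unit c z /\ v z = cocycle_shift c z.
  have [eta thetaK etaK] := theta_bij.
  have : eta z \in E by rewrite ET inE.
  by rewrite inE etaK => /andP[/eqP -> /eqP ->].
have [psi phiK psiK] := coord_bij Co.
exists psi; split; first by exists phi.
  by move=> g h; apply: (can_inj phiK); rewrite (coordM Co) !psiK.
move=> g h; apply: (can_inj phiK); rewrite psiK.
rewrite -{1}(psiK g) -{1}(psiK h) -(coord_circ Co); congr phi.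
by rewrite /affine_circ; have [-> ->] := uv (psi g).
Qed.

End Rigidity.

(** * Arithmetic modulo an even number *)

Section EvenModulus.
Variable m : nat.
Local Notation n := m.+3.
Local Notation R := 'I_m.+3.
Hypothesis odn : ~~ odd n.

Lemma even_half : n = (2 * n./2)%N.
Proof. by rewrite mul2n -[LHS]odd_double_half (negbTE odn). Qed.

Lemma val_natmul (z : R) j : val (z *+ j)%R = (z * j %% n)%N.
Proof. by rewrite Zp_mulrn. Qed.

Lemma zpar_half_kill (z : R) : (z *+ n./2 = 0)%R -> zpar z = false.
Proof.
move/(congr1 val); rewrite val_natmul => /eqP; rewrite -/(dvdn _ _).
rewrite {1}even_half dvdn_pmul2r // zparE // dvdn2.
by case: (odd z).
Qed.

Lemma zparM (x y : R) : zpar (x * y)%R = zpar x && zpar y.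
Proof.
rewrite !zparE // -[in LHS]/(val _) /= odd_mod ?oddM //.
by apply: negbTE; move: odn.
Qed.

Definition half : R := ((n./2)%:R)%R.
Local Notation h := half.

Lemma double_half : (2%:R * h = 0)%R.
Proof. by rewrite /half -natrM -even_half natr_n0. Qed.

(** Multiplication by n/2 only sees parity. *)
Lemma half_mul (x : R) : (h * x = if zpar x then h else 0)%R.
Proof.
have [i ->] := zmod_half x; rewrite zparD.
have -> : zpar (2%:R * i)%R = false.
  by rewrite zparM; apply/negbTE; rewrite negb_and zparE // orbC Zp_nat.
case: (odd x); rewrite /= ?zpar1 ?odn ?zpar0; ring: double_half.
Qed.

Lemma double_eq0 (z : R) : (2%:R * z = 0)%R -> z = 0%R \/ z = h.
Proof.
move=> z2; have : (2 * z %% n = 0)%N.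
  by rewrite mulnC -val_natmul -mulr_natl z2.
move/eqP; rewrite -/(dvdn _ _) {1}even_half dvdn_pmul2l //.
case/dvdnP=> q zE.
have : (q * n./2 < 2 * n./2)%N by rewrite -zE -even_half ltn_ord.
rewrite ltn_pmul2r // => q2.
rewrite -[z]natr_Zp zE; case: q q2 {zE} => [|[|//]] _; first by left.
by right; rewrite mul1n.
Qed.

(** A generator of the ideal (2) is twice a unit: if w = 2i and ij = 1 + n/2, one
of i and i + n/2 is a unit, by the parities of i and j. *)
Lemma unit_lift (w j : R) : zpar w = false -> (w * j = 2%:R)%R ->
  exists c c' : R, (c * c' = 1 /\ 2%:R * c = w)%R.
Proof.
move=> wE wj; have [i wi] := zmod_half w.
move: wE; rewrite zparE // => wE; rewrite wE addr0 in wi.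
have /double_eq0 [ij|ij] : (2%:R * (i * j - 1) = 0)%R.
- by rewrite mulrBr mulrA -wi wj mulr1 subrr.
- by exists i, j; rewrite -wi; split=> //; apply/eqP; rewrite -subr_eq0 ij.
have {}ij : (i * j = 1 + h)%R by rewrite -ij; ring.
have hi := half_mul i; have hj := half_mul j; have hh := half_mul h.
have pij : zpar i && zpar j = ~~ zpar h by rewrite -zparM ij zparD zpar1 odn.
have d2 := double_half.
have [zi|zi] := boolP (zpar i).
  exists i; exists (j + h)%R; split; last by rewrite -wi.
  rewrite zi in hi; ring: hi ij d2.
have [zj|zj] := boolP (zpar j).
  exists (i + h)%R, j; split; last by rewrite mulrDr d2 addr0 -wi.
  rewrite zj in hj; ring: hj ij d2.
exists (i + h)%R, (j + h)%R; split; last by rewrite mulrDr d2 addr0 -wi.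
rewrite (negbTE zi) in hi; rewrite (negbTE zj) in hj.
rewrite (negbTE zi) /= in pij; rewrite -[zpar h]negbK -pij /= in hh.
ring: hi hj hh ij d2.
Qed.

End EvenModulus.

(** * Every bidihedral brace is a model *)

Section Relations.
Variable m : nat.
Local Notation n := m.+3.
Local Notation R := 'I_m.+3.
Local Notation a := ((1%R, false) : gdih R).
Local Notation b := ((0%R, true) : gdih R).
Variables (G : finSkewBraceType) (phi : gdih R -> G) (u v : gdih R -> R).
Hypothesis Co : coordinates phi u v.
Variable theta : gdih R -> gdih R.
Hypotheses (theta_bij : bijective theta)
  (thetaM : forall x y, theta (x * y) = affine_circ u v (theta x) (theta y)).
Local Notation circ_uv := (affine_circ u v).
Let t1 : theta 1 = 1 := theta1 Co theta_bij thetaM.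

Lemma refl_sqr (i : R) : ((i, true) : gdih R) * ((i, true) : gdih R) = 1.
Proof. by rewrite gdihE /= subrr. Qed.

Lemma ab_refl : a * b = (1%R, true).
Proof. by rewrite gdihE /= addr0. Qed.

Lemma refl_decomp (i : R) : ((i, true) : gdih R) = a ^+ i * b.
Proof. by rewrite -gdih_natX gdihE /= addr0. Qed.

Lemma circ_uvE x y : circ_uv x y =
  ((x.1 + flip x.2 (u x * y.1 + (if y.2 then v x else 0)))%R, x.2 (+) y.2).
Proof. by []. Qed.

Lemma theta_unitM x y : u (theta (x * y)) = (u (theta x) * u (theta y))%R.
Proof.
by rewrite thetaM; have [-> _] := coord_cocycle Co (theta x) (theta y).
Qed.

Lemma theta_unitX x i : u (theta (x ^+ i)) = (u (theta x) ^+ i)%R.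
Proof.
elim: i => [|i IH]; first by rewrite t1 (coord_unit1 Co).
by rewrite expgS theta_unitM IH exprS.
Qed.

Lemma theta_sideM x y : (theta (x * y)).2 = (theta x).2 (+) (theta y).2.
Proof. by rewrite thetaM. Qed.

Lemma theta_sideX x i : (theta (x ^+ i)).2 = odd i && (theta x).2.
Proof.
elim: i => [|i IH]; first by rewrite t1.
by rewrite expgS theta_sideM IH /=; case: (odd i); case: (_.2).
Qed.

Lemma theta_side (i : R) e :
  (theta (i, e)).2 = (odd i && (theta a).2) (+) (e && (theta b).2).
Proof.
case: e; first by rewrite refl_decomp theta_sideM theta_sideX.
by rewrite gdih_natX theta_sideX addbF.
Qed.

Lemma theta_unit_refl (i : R) :
  (u (theta (i, true)) * u (theta (i, true)) = 1)%R.
Proof. by rewrite -theta_unitM refl_sqr t1 (coord_unit1 Co). Qed.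

(** Every element of a dihedral group is a product of two involutions, and u is a
homomorphism to a commutative group. *)
Lemma theta_unit_sqr x : (u (theta x) * u (theta x) = 1)%R.
Proof.
case: x => i [|]; first exact: theta_unit_refl.
have := theta_unit_refl i; rewrite refl_decomp theta_unitM -gdih_natX.
have := theta_unit_refl 0%R.
set x := u (theta b); set y := u (theta (i, false)) => xx yxyx.
by rewrite -[LHS]mulr1 -{1}xx -yxyx; ring.
Qed.

Lemma coord_unit_sqr x : (u x * u x = 1)%R.
Proof.
by have [eta thetaK etaK] := theta_bij; rewrite -(etaK x) theta_unit_sqr.
Qed.

Lemma coord_circ_rotX x (z : R) i : theta x = (z, false) -> u (theta x) = 1%R ->
  theta (x ^+ i) = ((z *+ i)%R, false).
Proof.
move=> tx ux; elim: i => [|i IH]; first by rewrite t1.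
rewrite expgS thetaM IH circ_uvE ux tx /= mul1r addr0.
by rewrite mulrS.
Qed.

(** The relation that the product of the two circle generators is an involution,
read in the first coordinate. *)
Lemma circ_abab : circ_uv (circ_uv a b) (circ_uv a b) = 1 ->
  (u a * u b * (1 + v a) + u a * v b = 1)%R.
Proof.
have [uab vab] := coord_cocycle Co a b.
rewrite [X in X = _]circ_uvE uab vab !circ_uvE /= => /(congr1 fst) /=.
rewrite mulr0 add0r => /eqP; rewrite subr_eq0 => /eqP e.
apply: (addrI (v a)); rewrite [RHS]addrC {2}e; ring.
Qed.

Lemma circ_bb : circ_uv b b = ((- v b)%R, false).
Proof. by rewrite circ_uvE /= mulr0 !add0r. Qed.

Lemma circ_aa : circ_uv a a = ((1 + u a)%R, false).
Proof. by rewrite circ_uvE /= mulr1 addr0. Qed.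

(** The relations b o b = 1 and (a o b) o (a o b) = 1 determine v. The condition
on p comes from writing 2 as a circle power of a: even powers are the multiples of
1 + p, and an odd power can only equal 2 when p = 1. *)
Lemma classify_cyclic : theta a = a -> theta b = b ->
  exists D : datum m, skew_brace_isomorphic G (model D).
Proof.
move=> ta tb; set p := u a; set k := u b.
have p2 : (p * p = 1)%R by rewrite coord_unit_sqr.
have k2 : (k * k = 1)%R by rewrite coord_unit_sqr.
have vb : v b = 0%R.
  have := circ_bb; rewrite -{1 2}tb -thetaM refl_sqr t1 => /(congr1 fst) /= e.
  by apply/eqP; rewrite -oppr_eq0 -e.
have va : v a = (p * k - 1)%R.
  have tab : theta (1%R, true) = circ_uv a b by rewrite -ab_refl thetaM ta tb.
  have := circ_abab; rewrite -tab -thetaM refl_sqr.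
  rewrite vb mulr0 addr0 -/p -/k => /(_ t1) e.
  apply: (addrI 1%R); rewrite [RHS]addrC subrK.
  have -> : (1 + v a = p * k * (p * k * (1 + v a)))%R by ring: p2 k2.
  by rewrite e mulr1.
have p_odd : odd n -> p = 1%R.
  move=> odn; have := theta_unitX a n.
  rewrite gdih_rotX natr_n0 t1 (coord_unit1 Co) ta -/p.
  rewrite -[X in (p ^+ X)%R]odd_double_half.
  rewrite odn -mul2n exprD exprM expr1 expr2 p2 expr1n mulr1.
  by move->.
have taX j : theta (a ^+ (2 * j)) = (((1 + p) *+ j)%R, false).
  rewrite expgM (coord_circ_rotX (z := (1 + p)%R)) //.
    by rewrite expgS expg1 thetaM ta circ_aa.
  by rewrite theta_unitX ta expr2.
have p_gen : exists j : R, (j * (1 + p) = 2%:R)%R.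
  have [eta thetaK etaK] := theta_bij.
  have := etaK (2%:R%R, false); case: (eta _) => i f tf.
  have f0 : f = false.
    by have := congr1 snd tf; rewrite theta_side ta tb andbF andbT.
  move: tf; rewrite f0 gdih_natX -[nat_of_ord i]odd_double_half -mul2n.
  case: (odd i); rewrite ?add0n ?add1n ?expgS ?thetaM taX -mulr_natl.
    rewrite ta circ_uvE /= addr0 => /(congr1 fst) /= e.
    exists 1%R; suff -> : p = 1%R by ring.
    set j := (_ %:R)%R in e.
    have {}e : (j * (1 + p) = 1)%R.
      apply: (addrI 1%R); apply: etrans e; rewrite -/p; ring: p2.
    rewrite -[LHS]mulr1 -{1}e -[RHS]e; ring: p2.
  by move/(congr1 fst) => /= e; exists (i./2)%:R%R.
have tp : false -> (p = -1)%R by [].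
have te : false -> ~~ odd n by [].
pose D := Datum p2 k2 tp p_odd te (fun _ => p_gen).
exists D; apply: (rigidity Co theta_bij thetaM _ ta tb).
- move=> H; exact: gdih_gen_ord.
- by rewrite datum_unit_rot.
- by rewrite datum_shift_rot va addr0.
- by rewrite datum_unit_refl.
- by rewrite datum_shift_refl vb.
Qed.

End Relations.

Section DihedralRotations.
Variable m : nat.
Local Notation n := m.+3.
Local Notation R := 'I_m.+3.
Local Notation a := ((1%R, false) : gdih R).
Local Notation b := ((0%R, true) : gdih R).
Variables (G : finSkewBraceType) (phi : gdih R -> G) (u v : gdih R -> R).
Hypothesis Co : coordinates phi u v.
Variable theta : gdih R -> gdih R.
Hypotheses (theta_bij : bijective theta)
  (thetaM : forall x y, theta (x * y) = affine_circ u v (theta x) (theta y)).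
Local Notation circ_uv := (affine_circ u v).
Let t1 : theta 1 = 1 := theta1 Co theta_bij thetaM.
Hypotheses (odn : ~~ odd n) (ta : theta a = b) (sb : (theta b).2 = false).

(** In this section the circle rotation of order n is b, so its even powers are
the dot rotations by multiples of - v b. *)
Lemma theta_even j : theta (a ^+ (2 * j)) = ((- v b *+ j)%R, false).
Proof.
rewrite expgM (coord_circ_rotX Co theta_bij thetaM (z := (- v b)%R)) //.
  by rewrite expgS expg1 thetaM ta circ_bb.
by rewrite (theta_unitX Co theta_bij thetaM) expr2;
   apply: (theta_unit_sqr Co theta_bij thetaM).
Qed.

Lemma theta_unit_even j : u (theta (a ^+ (2 * j))) = 1%R.
Proof.
rewrite (theta_unitX Co theta_bij thetaM) exprM expr2.
by rewrite (theta_unit_sqr Co theta_bij thetaM) expr1n.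
Qed.

(** Half of n times v b vanishes, because b has circle order dividing n. *)
Lemma zpar_shift_refl : zpar (v b) = false.
Proof.
rewrite -(zpar_half_kill odn (z := (- v b)%R)).
  by rewrite (parN (@zparD m)).
have := theta_even n./2; rewrite -even_half // gdih_rotX natr_n0 t1.
by move/(congr1 fst).
Qed.

Lemma zpar_even_theta (z : R) i :
  theta (a ^+ (2 * i)) = (z, false) -> zpar z = false.
Proof.
rewrite theta_even => /(congr1 fst) /= <-.
by rewrite -mulr_natr zparM // (parN (@zparD m)) zpar_shift_refl.
Qed.

Lemma theta_rot_even (z : R) x : theta x = (z, false) -> ~~ odd x.1.
Proof.
case: x => i e /(congr1 snd) /=.
rewrite (theta_side Co theta_bij thetaM) ta sb andbT andbF addbF.
by move=> ->.
Qed.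

(** The circle powers of b that are dot rotations have even angle, so the odd
angle 1 belongs to a circle reflection. *)
Lemma reflection_over_rot : exists i, theta (i, true) = a.
Proof.
have [eta thetaK etaK] := theta_bij.
have := etaK a; case: (eta a) => i [] ti; first by exists i.
have /= odi := theta_rot_even ti.
move: ti; rewrite gdih_natX -[nat_of_ord i]odd_double_half (negbTE odi) -mul2n.
by move/zpar_even_theta; rewrite zpar1 odn.
Qed.

(** The same parity argument for the angle 2: among the dot rotations, the circle
reflections are those of odd angle, so 2 is reached by an even power of b. *)
Lemma shift_refl_gen : exists j : R, (- v b * j = 2%:R)%R.
Proof.
have [i ti] := reflection_over_rot.
have [eta thetaK etaK] := theta_bij.
have evenE (j : R) : ~~ odd j -> a ^+ j = a ^+ (2 * j./2).
  by move=> odj; rewrite mul2n -{1}[nat_of_ord j]odd_double_half (negbTE odj).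
have := etaK (2%:R%R, false); case: (eta _) => j [] tj; last first.
  have /= odj := theta_rot_even tj.
  exists (j./2)%:R%R; move: tj; rewrite gdih_natX evenE //.
  by rewrite theta_even mulr_natr => /(congr1 fst).
have odi := theta_rot_even ti; have odj := theta_rot_even tj.
have odji : ~~ odd (j - i)%R.
  rewrite -zparE // zparD (parN (@zparD m)) !zparE //.
  by rewrite (negbTE odi) (negbTE odj).
have jE : ((j, true) : gdih R)
          = (((j - i)%R, false) : gdih R) * ((i, true) : gdih R).
  by rewrite gdihE /= subrK.
have [z tz] : exists z, theta (a ^+ (2 * (j - i)%R./2)) = (z, false).
  by eexists; apply: theta_even.
have := tj; rewrite jE thetaM ti gdih_natX evenE // circ_uvE.
rewrite theta_unit_even tz /= mul1r addr0 => /(congr1 fst) /= e.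
have := zpar1 m; rewrite -(addbF (zpar _)) -(zpar_even_theta tz) addbC -zparD e.
rewrite odn.
by rewrite -[2%:R%R]mulr1 (par_double (@zparD m)).
Qed.

Lemma classify_dihedral : v b = (- 2%:R)%R ->
  exists D : datum m, skew_brace_isomorphic G (model D).
Proof.
move=> vb; have [i ti] := reflection_over_rot.
set q := u b.
have sqr := coord_unit_sqr Co theta_bij thetaM.
have q2 : (q * q = 1)%R by apply: sqr.
have p1 : (u a = -1)%R.
  have := circ_aa u v; rewrite -{1 2}ti -thetaM refl_sqr t1.
  by move/(congr1 fst)/esym/eqP; rewrite /= addrC addr_eq0 => /eqP.
have va : v a = (q - 1)%R.
  have tab : theta (((i, true) : gdih R) * a) = circ_uv a b.
    by rewrite thetaM ti ta.
  have := circ_abab Co; rewrite -tab -thetaM.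
  have -> : ((i, true) : gdih R) * a = (i - 1, true)%R by rewrite gdihE.
  rewrite refl_sqr p1 vb -/q => /(_ t1) e.
  have {}e : (q * (1 + v a) = 1)%R.
    by apply: (addrI 1%R); rewrite -[X in (X + _ = _)%R]e; ring.
  apply: (addrI 1%R); rewrite [RHS]addrC subrK.
  have -> : (1 + v a = q * (q * (1 + v a)))%R by ring: q2.
  by rewrite e mulr1.
have m1 : (-1 * -1 = 1 :> R)%R by rewrite mulrNN mulr1.
have m1_odd : odd n -> (-1 = 1 :> R)%R by move=> odn'; case/negP: odn.
have no_gen : ~~ true -> exists j : R, (j * (1 + -1) = 2%:R)%R by [].
pose D := Datum m1 q2 (fun _ : true => erefl) m1_odd (fun _ => odn) no_gen.
exists D; apply: (rigidity Co theta_bij thetaM _ ti ta).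
- by move=> H Hi Ha; apply: gdih_gen_ord Ha Hi.
- by rewrite datum_unit_rot.
- by rewrite datum_shift_rot va /=; ring.
- by rewrite datum_unit_refl.
- by rewrite datum_shift_refl vb.
Qed.

End DihedralRotations.

Section Completeness.
Variable m : nat.
Local Notation n := m.+3.
Local Notation R := 'I_m.+3.
Local Notation a := ((1%R, false) : gdih R).
Local Notation b := ((0%R, true) : gdih R).
Variable G : finSkewBraceType.

Lemma theta_exists (phi : gdih R -> G) u v (chi : gdih R -> G) :
    coordinates phi u v -> bijective chi ->
    (forall x y, chi (x * y) = chi x \o_b chi y) ->
  exists theta : gdih R -> gdih R, [/\ bijective theta,
    forall x y, theta (x * y) = affine_circ u v (theta x) (theta y)
    & forall x, phi (theta x) = chi x].
Proof.
move=> Co chi_bij chiM; have [psi phiK psiK] := coord_bij Co.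
exists (psi \o chi); split=> [|x y|x] /=; last by rewrite psiK.
  by apply: bij_comp chi_bij; exists phi.
by apply: (can_inj phiK); rewrite (coord_circ Co) !psiK.
Qed.

(** The dot rotation chi a generates the dot rotations, because the multiples of
its angle are stable under circle multiplication by it; so coordinates may be
changed to make it (1, 0). *)
Lemma complete_cyclic (phi : gdih R -> G) u v (chi : gdih R -> G) (t s : R) :
    coordinates phi u v -> bijective chi ->
    (forall x y, chi (x * y) = chi x \o_b chi y) ->
    chi a = phi (t, false) -> chi b = phi (s, true) ->
  exists D : datum m, skew_brace_isomorphic G (model D).
Proof.
move=> Co chi_bij chiM chia chib.
have phi_inj := bij_inj (coord_bij Co).
have [theta [theta_bij thetaM phi_theta]] := theta_exists Co chi_bij chiM.
have ta : theta a = (t, false) by apply: phi_inj; rewrite phi_theta.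
have tb : theta b = (s, true) by apply: phi_inj; rewrite phi_theta.
have [t' tt'] : exists t', (t * t' = 1)%R.
  have taX i : exists z, theta (a ^+ i) = (t * z, false)%R.
    elim: i => [|i [z IH]].
      by exists 0%R; rewrite (theta1 Co theta_bij thetaM) mulr0.
    exists (1 + u (t, false) * z)%R.
    by rewrite expgS thetaM IH ta circ_uvE /= addr0; congr (_, _); ring.
  have [eta thetaK etaK] := theta_bij; have := etaK a.
  case: (eta a) => i e te; have e0 : e = false.
    have := congr1 snd te.
    by rewrite (theta_side Co theta_bij thetaM) ta tb andbF andbT.
  move: te; rewrite e0 gdih_natX; have [z ->] := taX i.
  by move/(congr1 fst) => /= tz; exists z.
have [u' [v' Co']] := coord_change Co s tt'.
have [theta' [theta'_bij theta'M phi_theta']] := theta_exists Co' chi_bij chiM.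
have phi'_inj := bij_inj (coord_bij Co').
apply: (classify_cyclic Co' theta'_bij theta'M); apply: phi'_inj;
  rewrite phi_theta' /affine /=.
- by rewrite mulr1 addr0.
- by rewrite mulr0 add0r.
Qed.

(** Two changes of coordinates: the first moves the circle rotation to (0, 1), the
second rescales the dot rotations so that its circle square is (2, 0). *)
Lemma complete_dihedral (phi : gdih R -> G) u v (chi : gdih R -> G) (s t : R) :
    coordinates phi u v -> bijective chi ->
    (forall x y, chi (x * y) = chi x \o_b chi y) ->
    chi a = phi (s, true) -> chi b = phi (t, false) ->
  exists D : datum m, skew_brace_isomorphic G (model D).
Proof.
move=> Co0 chi_bij chiM chia chib.
have [u1 [v1 Co]] := coord_change Co0 s (mulr1 (1%R : R)).
have phi_inj := bij_inj (coord_bij Co).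
have [theta [theta_bij thetaM phi_theta]] := theta_exists Co chi_bij chiM.
have ta : theta a = b.
  by apply: phi_inj; rewrite phi_theta chia /affine /= mulr0 add0r.
have sb : (theta b).2 = false.
  suff -> : theta b = (t, false) by [].
  by apply: phi_inj; rewrite phi_theta chib /affine /= mul1r addr0.
have odn : ~~ odd n.
  apply/negP => odn; have := theta_sideX Co theta_bij thetaM a n.
  by rewrite gdih_rotX natr_n0 (theta1 Co theta_bij thetaM) ta odn.
have [j wj] := shift_refl_gen Co theta_bij thetaM odn ta sb.
have zw : zpar (- v1 b)%R = false.
  by rewrite (parN (@zparD m)) (zpar_shift_refl Co theta_bij thetaM).
have [c [c' [cc' cw]]] := unit_lift odn zw wj.
have [u2 [v2 Co2]] := coord_change Co 0%R cc'.
have phi2_inj := bij_inj (coord_bij Co2).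
have [th2 [th2_bij th2M phi_th2]] := theta_exists Co2 chi_bij chiM.
have th2E x : affine c 0%R (th2 x) = theta x.
  by apply: phi_inj; rewrite phi_theta -phi_th2.
have t2a : th2 a = b.
  have cb : affine c 0%R b = b by rewrite /affine /= mulr0 addr0.
  by apply: phi2_inj; rewrite phi_th2 -phi_theta ta -[in LHS]cb.
have s2b : (th2 b).2 = false by rewrite -sb -th2E.
apply: (classify_dihedral Co2 th2_bij th2M odn t2a s2b).
have := th2E (a * a); rewrite th2M thetaM t2a ta !circ_bb.
move/(congr1 fst); rewrite /= addr0 -cw => e.
have -> : (v2 b = c' * c * v2 b)%R by rewrite [(c' * c)%R]mulrC cc' mul1r.
rewrite -mulrA -[(c * _)%R]opprK -mulrN e mulrN mulrCA [(c' * c)%R]mulrC cc'.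
by rewrite mulr1.
Qed.

Theorem bidihedral_complete :
  bidihedral n G -> exists D : datum m, skew_brace_isomorphic G (model D).
Proof.
case=> /dihedral_elim [//|cardG [r [s [rs gen_rs]]]].
case/dihedral_elim=> // cardcG [r' [s' [rs' gen_rs']]].
have [phi [phi_bij phiM _ _]] := dihedral_coord rs gen_rs cardG.
have [chi [chi_bij chiM _ _]] := dihedral_coord rs' gen_rs' cardcG.
have [u [v Co]] := coordinates_exist phi_bij phiM.
have [psi phiK psiK] := phi_bij.
have := psiK (chi a); have := psiK (chi b).
case: (psi (chi b)) => t f chib; case: (psi (chi a)) => i e chia.
case: e chia => chia; case: f chib => chib.
(* Replace the circle reflection by its product with the circle rotation. *)
- pose chi' := chi \o affine 1%R 1%R.
  have chi'_bij : bijective chi'.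
    apply: bij_comp chi_bij _; exists (affine 1%R (-1)%R) => x;
      by rewrite affine_comp ?mulr1 ?mul1r ?subrr ?addNr affine1.
  have chi'M x y : chi' (x * y) = chi' x \o_b chi' y.
    by rewrite /chi' /= affineM chiM.
  have chi'a : chi' a = chi a by rewrite /chi' /affine /= mul1r addr0.
  have chi'b : chi' b = chi a \o_b chi b.
    by rewrite -[RHS]chiM ab_refl /chi' /affine /= mulr0 add0r.
  have [z zE] : exists z, chi' b = phi (z, false).
    rewrite chi'b -chia -chib -(coord_circ Co) circ_uvE /=.
    by eexists.
  by apply: (complete_dihedral (s := i) Co chi'_bij chi'M _ zE); rewrite chi'a.
- exact: (complete_dihedral Co chi_bij chiM (esym chia) (esym chib)).
- exact: (complete_cyclic Co chi_bij chiM (esym chia) (esym chib)).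
have phi_inj := bij_inj (coord_bij Co).
have [theta [theta_bij thetaM phi_theta]] := theta_exists Co chi_bij chiM.
have ta : theta a = (i, false) by apply: phi_inj; rewrite phi_theta.
have tb : theta b = (t, false) by apply: phi_inj; rewrite phi_theta.
have [eta thetaK etaK] := theta_bij.
have := congr1 snd (etaK b); case: (eta b) => j e.
by rewrite (theta_side Co theta_bij thetaM) ta tb !andbF.
Qed.

End Completeness.

(** * Isomorphism invariants *)

Section Invariants.
Variable m : nat.
Local Notation n := m.+3.
Local Notation R := 'I_m.+3.
Local Notation a := ((1%R, false) : gdih R).
Local Notation b := ((0%R, true) : gdih R).
Implicit Types D : datum m.

(** An isomorphism is an automorphism of the dihedral group, and automorphisms
commute on rotations, where u is read off: so u is preserved. *)
Lemma model_iso_affine D D' : skew_brace_isomorphic (model D) (model D') ->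
  exists c d : R, [/\ injective (fun z : R => c * z)%R,
    forall x, cocycle_unit (datum_cocycle D') (affine c d x)
              = cocycle_unit (datum_cocycle D) x
    & forall x y, affine c d ((x : model D) \o_b y)
                  = (affine c d x : model D') \o_b affine c d y].
Proof.
case=> f [/bij_inj f_inj fM fcirc].
pose L : gdih R -> gdih R := f.
have LE : L =1 affine (L a).1 (L b).1 by apply: gdih_endo.
set c := (L a).1 in LE; set d := (L b).1 in LE.
have c_inj : injective (fun z : R => c * z)%R.
  move=> z z' /= e; suff : L (z, false) = L (z', false) by move/f_inj => [].
  by rewrite !LE /affine /= e.
have circL x y : affine c d ((x : model D) \o_b y)
                  = (affine c d x : model D') \o_b affine c d y.
  by rewrite -!LE; apply: fcirc.
exists c, d; split=> // x; apply: c_inj; rewrite /= [RHS]mulrC.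
have : affine c d (affine_circ (cocycle_unit (datum_cocycle D))
                     (cocycle_shift (datum_cocycle D)) x a)
       = affine_circ (cocycle_unit (datum_cocycle D'))
           (cocycle_shift (datum_cocycle D')) (affine c d x) (affine c d a).
  exact: circL.
rewrite /affine_circ affineM => /mulgI /(congr1 fst).
by rewrite /= !mulr1 !addr0 => e; rewrite [LHS]mulrC -e mulrC.
Qed.

Lemma datum_unit_rotE D z :
  cocycle_unit (datum_cocycle D) (z, false)
    = if zpar z then rot_unit D else 1%R.
Proof. by rewrite datum_unitE /family_unit mulr1. Qed.

Lemma datum_unit_reflE D z :
  cocycle_unit (datum_cocycle D) (z, true)
    = ((if zpar z then rot_unit D else 1) * refl_unit D)%R.
Proof. by rewrite datum_unitE. Qed.

Lemma model_iso_rot_unit D D' :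
  skew_brace_isomorphic (model D) (model D') ->
  rot_unit D = 1%R \/ rot_unit D = rot_unit D'.
Proof.
case/model_iso_affine=> c [d [_ uE _]]; rewrite -(datum_unit_rot D) -uE.
by rewrite /affine /= mulr1 addr0 datum_unit_rotE; case: ifP; [right | left].
Qed.

Lemma skew_brace_isomorphic_sym (G H : skewBraceType) :
  skew_brace_isomorphic G H -> skew_brace_isomorphic H G.
Proof.
case=> f [f_bij fM fcirc]; have [g fK gK] := f_bij.
exists g; split; first by exists f.
  by move=> x y; apply: (can_inj fK); rewrite fM !gK.
by move=> x y; apply: (can_inj fK); rewrite fcirc !gK.
Qed.

Lemma skew_brace_isomorphic_trans (G H K : skewBraceType) :
  skew_brace_isomorphic G H -> skew_brace_isomorphic H K ->
  skew_brace_isomorphic G K.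
Proof.
case=> f [f_bij fM fcirc] [g [g_bij gM gcirc]].
exists (g \o f); split; first exact: bij_comp.
  by move=> x y /=; rewrite fM gM.
by move=> x y /=; rewrite fcirc gcirc.
Qed.

Lemma datum_interchanged D : interchanged D = (rot_unit D == -1)%R.
Proof.
have [/interchanged_rot_unit -> | ntD] := boolP (interchanged D).
  by rewrite eqxx.
apply/esym/negbTE/eqP => pE; have [j] := rot_unit_gen ntD.
rewrite pE subrr mulr0 => /eqP.
by rewrite eq_sym (negPf (two_neq0 m)).
Qed.

(** The values of u on dot rotations determine p, and with it the family. A
reflection may still exchange k for pk. In the interchanged family this is
excluded: the image of b has to have a nontrivial circle square, and then its
angle is even. *)
Lemma model_iso_inv D D' : skew_brace_isomorphic (model D) (model D') ->
  [/\ interchanged D = interchanged D', rot_unit D = rot_unit D'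
    & refl_unit D = refl_unit D' \/
      ~~ interchanged D /\ refl_unit D = (rot_unit D * refl_unit D')%R].
Proof.
move=> iso.
have pE : rot_unit D = rot_unit D'.
  case: (model_iso_rot_unit iso) => // p1.
  case: (model_iso_rot_unit (skew_brace_isomorphic_sym iso)) => // p1'.
  by rewrite p1.
have tE : interchanged D = interchanged D' by rewrite !datum_interchanged pE.
split=> //; have [c [d [c_inj uE circE]]] := model_iso_affine iso.
have db : affine c d b = (d, true) by rewrite /affine /= mulr0 add0r.
have := uE b; rewrite db datum_unit_refl datum_unit_reflE.
have [zd|_ <-] := boolP (zpar d); last by left; rewrite mul1r.
rewrite -pE => <-; right; split=> //; apply/negP => tD.
have := circE b b; rewrite db.
have -> : (b : model D) \o_b b = (2%:R%R, false).
  by rewrite [LHS](model_bb D) tD.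
rewrite [RHS](cocycle_circE (c := datum_cocycle D') (d, true) (d, true)).
move/(congr1 fst); rewrite /= datum_unit_reflE datum_shiftE /family_shift /= zd.
rewrite andbF /= -pE (interchanged_rot_unit tD) !addr0 => e.
have : (c * 2%:R = c * 0 :> R)%R by rewrite e; ring.
by move/c_inj/eqP; rewrite (negPf (two_neq0 m)).
Qed.

End Invariants.

(** * Order two *)

Lemma order2_neq1M (gT : finGroupType) (g h : gT) : #|gT| = 2 ->
  (g * h != 1) = (g != 1) (+) (h != 1).
Proof.
move=> card2; have [->|g1] := eqVneq g 1; first by rewrite mul1g.
have [->|h1] := eqVneq h 1; first by rewrite mulg1 g1.
have /cards1P[x xE] : #|[set~ (1 : gT)]| == 1%N by rewrite cardsC1 card2.
have nt y : (y != 1) = (y == x) by rewrite -[RHS]in_set1 -xE !inE.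
rewrite /= nt; apply/negbTE; move: g1 h1; rewrite !nt => /eqP-> /eqP h1.
by rewrite h1 -[X in _ == X]mulg1 (inj_eq (mulgI x)) nt eqxx.
Qed.

Lemma num_iso_classes_order2 : num_iso_classes (bidihedral 1) 1%N.
Proof.
pose B0 : finSkewBraceType := trivial_brace (gdih 'I_1).
exists (fun=> B0); split=> [_|i j _|G [/dihedral_elim[//|cardG _]
    /dihedral_elim[//|cardcG _]]].
- by split; exact: (dihedral_gdih 0).
- by rewrite !ord1.
exists ord0; pose f (g : G) : B0 := (0%R : 'I_1, g != 1).
have f_inj : injective f.
  move=> g h [e]; apply/eqP; rewrite -(can_eq (mulKg g^-1)) mulVg eq_sym.
  have := order2_neq1M g^-1 h cardG.
  by rewrite invg_eq1 e addbb => /negbFE.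
have fM s t : ((0%R, s) : gdih 'I_1) * ((0%R, t) : gdih 'I_1) = (0%R, s (+) t).
  by rewrite gdihE; congr (_, _); rewrite [LHS]ord1.
exists f; split.
- by apply: inj_card_bij => //; rewrite cardG card_gdih card_ord.
- by move=> g h; rewrite [RHS]fM /f (order2_neq1M g h cardG).
move=> g h; rewrite [RHS]fM /f; congr (_, _).
have one_circ : (1 : circ_group G) = (1 : G) := circ_one1 G.
have := order2_neq1M (g : circ_group G) h cardcG.
by rewrite one_circ.
Qed.

(** * Counting the classes *)

Section Count.
Variable m : nat.
Local Notation n := m.+3.
Local Notation R := 'I_m.+3.
Local Notation half := (half m).

Definition sqrt1 : {set R} := [set k : R | k * k == 1]%R.

Lemma sqrt1E : K n = sqrt1.
Proof. by apply/setP=> k; rewrite !inE. Qed.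

(** Representatives for k ~ k + n/2. *)
Definition low_sqrt1 : {set R} := [set k in sqrt1 | (k < n./2)%N].

Definition cyclic_params : {set bool * R * R} :=
  [set (false, 1%R, k) | k in sqrt1].
Definition twisted_params : {set bool * R * R} :=
  if 8 %| n then [set (false, (1 + half)%R, k) | k in low_sqrt1] else set0.
Definition dihedral_params : {set bool * R * R} :=
  if odd n then set0 else [set (true, (-1)%R, k) | k in sqrt1].
Definition params := cyclic_params :|: twisted_params :|: dihedral_params.

Lemma half_neq0 : ~~ odd n -> half != 0%R.
Proof.
move=> odn; have nE := even_half odn.
rewrite /half Zp_nat -val_eqE -[val (inZp _)]/(n./2 %% n)%N.
rewrite modn_small; last by rewrite {2}nE; lia.
by apply/negP=> /eqP h0; move: nE; rewrite h0.
Qed.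

Lemma card_params :
  #|params| = (#|sqrt1| + (if 8 %| n then #|low_sqrt1| else 0)
              + (if odd n then 0 else #|sqrt1|))%N.
Proof.
have inj t p : injective (fun k : R => (t, p, k) : bool * R * R).
  by move=> k k' [].
have ev : 8 %| n -> ~~ odd n by lia.
rewrite /params cardsU (_ : _ :&: _ = set0) ?cards0 ?subn0; last first.
  apply/setP=> -[[t p] k]; rewrite !inE; apply/negP => /andP[].
  rewrite /twisted_params /dihedral_params.
  case: (odd n); first by rewrite inE.
  move=> h /imsetP[k' _ [tE _ _]]; move: h; rewrite tE => /orP[].
    by case/imsetP.
  by case: ifP; rewrite ?inE // => _ /imsetP[].
rewrite cardsU (_ : _ :&: _ = set0) ?cards0 ?subn0; last first.
  apply/setP=> -[[t p] k]; rewrite !inE; apply/negP => /andP[].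
  case/imsetP=> k' _ [_ pE _]; rewrite /twisted_params.
  case: ifP; rewrite ?inE // => n8 /imsetP[k'' _ [_ pE' _]].
  have /negP := half_neq0 (ev n8); apply; apply/eqP.
  by apply: (addrI 1%R); rewrite -pE' pE addr0.
rewrite /cyclic_params /twisted_params /dihedral_params card_imset //.
by congr (_ + _ + _)%N; case: ifP => _; rewrite ?cards0 // card_imset.
Qed.

End Count.

Lemma half_shift_lt k h : (k < 2 * h)%N ->
  ((k + h) %% (2 * h) < h)%N = ~~ (k < h)%N.
Proof.
case: (ltnP k h) => [kh _|hk kh]; first by rewrite modn_small; lia.
have -> : (k + h = k - h + 2 * h)%N by lia.
by rewrite modnDr modn_small; lia.
Qed.

Section Params.
Variable m : nat.
Local Notation n := m.+3.
Local Notation R := 'I_m.+3.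
Local Notation half := (half m).
Implicit Types D : datum m.

Definition datum_param D : bool * R * R :=
  (interchanged D, rot_unit D, refl_unit D).

Lemma zpar_sqrt1 (k : R) : ~~ odd n -> (k * k = 1)%R -> zpar k.
Proof. by move=> odn k2; rewrite -[k]mulr1 zpar_unit // zpar1. Qed.

Lemma zpar_nat (q : nat) : ~~ odd n -> zpar (q%:R : R)%R = odd q.
Proof.
move=> odn; rewrite zparE // Zp_nat -[nat_of_ord _]/(q %% n)%N odd_mod //.
exact: negbTE.
Qed.

Lemma val_half : ~~ odd n -> val half = n./2.
Proof.
move=> odn; have nE := even_half odn.
rewrite /half Zp_nat -[val (inZp _)]/(n./2 %% n)%N modn_small //.
by rewrite {2}nE; lia.
Qed.

Lemma half_val_double (q : nat) : n = (2 * (2 * q))%N ->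
  (half = 2%:R * q%:R)%R.
Proof.
by move=> nq; rewrite -natrM /half; congr (_%:R)%R; rewrite {1}nq mul2n doubleK.
Qed.

Lemma twist_sqr : 8 %| n -> ((1 + half) * (1 + half) = 1)%R.
Proof.
move=> n8; have odn : ~~ odd n by lia.
have hh := half_mul odn half.
have hE : zpar half = false by rewrite zparE // val_half //; lia.
have d2 := double_half odn.
rewrite hE in hh; ring: hh d2.
Qed.

Lemma twist_gen : 8 %| n -> exists j : R, (j * (1 + (1 + half)) = 2%:R)%R.
Proof.
move=> n8; have odn : ~~ odd n by lia.
have [q nq] : exists q, n = (2 * (2 * (2 * q)))%N by exists (n %/ 8); lia.
have hE := half_val_double nq.
have hq := half_mul odn (2 * q)%:R%R.
have qE : zpar ((2 * q)%:R : R)%R = false.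
  by rewrite natrM (par_double (@zparD m)).
rewrite qE in hq; (* The witness 1 - n/4. *)
exists (1 - (2 * q)%:R)%R.
rewrite hE; rewrite hE in hq; move: ((2 * q)%:R)%R hq => y hq.
have -> : ((1 - y) * (1 + (1 + 2%:R * y)) = 2%:R - 2%:R * y * y)%R by ring.
by rewrite hq subr0.
Qed.

(** From 2 (p - 1) = j (1 + p) (p - 1) = 0 one gets p = 1 or p = 1 + n/2. In the
latter case p is odd, so 4 divides n, and 2 = j (2 + n/2) forces j and 1 + n/4 to
be odd, so 8 divides n. *)
Lemma unit_rot_cases (p j : R) : ~~ odd n -> (p * p = 1)%R ->
  (j * (1 + p) = 2%:R)%R -> p = 1%R \/ 8 %| n /\ p = (1 + half)%R.
Proof.
move=> odn p2 jp; have /(double_eq0 odn) : (2%:R * (p - 1) = 0)%R.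
  rewrite -jp; ring: p2.
case=> pE; first by left; apply/eqP; rewrite -subr_eq0 pE.
have {}pE : p = (1 + half)%R by rewrite -pE addrC subrK.
right; split=> //.
have ph : zpar half = false.
  by have := zpar_sqrt1 odn p2; rewrite pE zparD zpar1 odn; case: (zpar half).
have h2 : ~~ odd n./2 by rewrite -val_half // -zparE ?ph.
have [q nq] : exists q, n = (2 * (2 * q))%N.
  by exists (n./2)./2; rewrite {1}(even_half odn); lia.
have hE := half_val_double nq.
have : (2%:R * (j * (1 + q%:R) - 1) = 0)%R.
  have -> : (2%:R * (j * (1 + q%:R) - 1) = j * (1 + p) - 2%:R)%R.
    by rewrite pE hE; ring.
  by rewrite jp subrr.
have zq z : z = 0%R \/ z = half -> zpar z = false by case=> -> //; apply: zpar0.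
move/(double_eq0 odn)/zq.
rewrite zparD (parN (@zparD m)) zpar1 odn zparM // zparD zpar1 odn zpar_nat //.
by case: (zpar j) => //; case oq : (odd q) => // _; lia.
Qed.

Lemma twist_low (k : R) : 8 %| n -> (k * k = 1)%R ->
  (((1 + half) * k)%R < n./2) = ~~ (k < n./2).
Proof.
move=> n8 k2; have odn : ~~ odd n by lia.
have -> : ((1 + half) * k = k + half)%R.
  by rewrite mulrDl mul1r half_mul // zpar_sqrt1.
rewrite -[nat_of_ord (k + half)%R]/((k + val half) %% n)%N val_half //.
have := ltn_ord k; move: (nat_of_ord k) => x.
rewrite [X in (x < X)%N -> _](even_half odn).
by rewrite [X in (_ %% X)%N](even_half odn); apply: half_shift_lt.
Qed.

Lemma datum_of_param x : x \in params m -> exists D, datum_param D = x.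
Proof.
case: x => [[t p] k]; rewrite /params /twisted_params /dihedral_params !inE.
have tf : false -> ~~ odd n by [].
case/orP=> [/orP[/imsetP[k' k2 [-> -> ->]]|]|].
- rewrite inE in k2; have {}k2 := eqP k2.
  have tp : false -> (1 = -1 :> R)%R by [].
  have gen : ~~ false -> exists j : R, (j * (1 + 1) = 2%:R)%R.
    by exists 1%R; rewrite mul1r.
  by exists (Datum (mulr1 1%R) k2 tp (fun _ => erefl) tf gen).
- case: ifP => [n8|]; last by rewrite inE.
  case/imsetP=> k' k2 [-> -> ->]; move: k2; rewrite inE inE.
  case/andP=> /eqP k2 _.
  have tp : false -> (1 + half = -1 :> R)%R by [].
  have podd : odd n -> (1 + half = 1)%R by lia.
  by exists (Datum (twist_sqr n8) k2 tp podd tf (fun _ => twist_gen n8)).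
case: ifP => [|odn]; first by rewrite inE.
case/imsetP=> k' k2 [-> -> ->]; move: k2; rewrite inE => /eqP k2.
have m1 : (-1 * -1 = 1 :> R)%R by rewrite mulrNN mulr1.
have m1_odd : odd n -> (-1 = 1 :> R)%R by rewrite odn.
have no_gen : ~~ true -> exists j : R, (j * (1 + -1) = 2%:R)%R by [].
have te : true -> ~~ odd n by rewrite odn.
by exists (Datum m1 k2 (fun _ : true => erefl) m1_odd te no_gen).
Qed.

(** The isomorphism trades the generators (a, b) of the circle group for
(a, a o b), which are again of the normalised form once a o b is moved to
(0, 1). *)
Lemma model_twist D D' : ~~ odd n -> ~~ interchanged D -> ~~ interchanged D' ->
    rot_unit D = (1 + half)%R -> rot_unit D' = (1 + half)%R ->
    refl_unit D = (rot_unit D * refl_unit D')%R ->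
  skew_brace_isomorphic (model D) (model D').
Proof.
move=> odn /negbTE tD /negbTE tD' pD pD' kD.
pose p : R := (1 + half)%R; rewrite -/p in pD pD' *.
set k : R := refl_unit D' in kD; pose c : R := (p * k)%R.
have p2 : (p * p = 1)%R by rewrite -pD rot_unit_sqr.
have k2 : (k * k = 1)%R by rewrite refl_unit_sqr.
rewrite pD in kD.
pose f : gdih R -> gdih R := affine 1%R c.
have f_bij : bijective f.
  exists (affine 1%R (- c)%R) => x;
    by rewrite /f affine_comp !mul1r ?subrr ?addNr affine1.
exists f; split=> //; first exact: affineM.
move=> x y.
have uE : cocycle_unit (datum_cocycle D') (f x)
            = cocycle_unit (datum_cocycle D) x.
  rewrite !datum_unitE /family_unit pD pD' kD /= mul1r zparD.
  have zc : zpar c.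
    by apply: zpar_sqrt1 => //; rewrite /c mulrACA p2 k2 mulr1.
  by case: x.2; rewrite ?zc ?zpar0 ?addbF ?addbT;
    case: (zpar x.1) => /=; rewrite ?mul1r ?mulr1 //= /k ?mulrA ?p2 ?mul1r.
have vE : (cocycle_shift (datum_cocycle D') (f x)
             + cocycle_unit (datum_cocycle D') (f x) * c
           = c + cocycle_shift (datum_cocycle D) x)%R.
  rewrite uE !datum_shiftE datum_unitE /family_unit /family_shift tD tD' /=.
  rewrite pD pD' kD !addr0 mul1r -/k /c.
  have hx := half_mul odn x.1.
  have hE : half = (p - 1)%R by rewrite /p addrC addKr.
  have hk := half_mul odn k; rewrite zpar_sqrt1 // in hk.
  have pk : (p * k = k + (p - 1))%R by rewrite -hE -[in RHS]hk hE; ring.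
  have px : (p * x.1 = x.1 + if zpar x.1 then p - 1 else 0)%R.
    by rewrite -hE -hx hE; ring.
  move: px; case: (zpar x.1) => px; case: x.2 => /=; rewrite ?addr0;
    ring: px pk p2 k2.
suff : f (affine_circ (cocycle_unit (datum_cocycle D))
                   (cocycle_shift (datum_cocycle D)) x y)
       = affine_circ (cocycle_unit (datum_cocycle D'))
           (cocycle_shift (datum_cocycle D')) (f x) (f y) by [].
rewrite /affine_circ {1}/f affineM {3}/f !affine_comp mul1r mulr1.
by rewrite vE uE mul1r.
Qed.

Lemma model_param_iso D D' : datum_param D = datum_param D' ->
  skew_brace_isomorphic (model D) (model D').
Proof.
case=> tE pE kE; exists id; split=> //; first by exists id.
move=> x y.
suff : affine_circ (cocycle_unit (datum_cocycle D))
         (cocycle_shift (datum_cocycle D)) x y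
       = affine_circ (cocycle_unit (datum_cocycle D'))
           (cocycle_shift (datum_cocycle D')) x y by [].
by rewrite /affine_circ !datum_unitE !datum_shiftE tE pE kE.
Qed.

Lemma param_of_datum D : exists D', datum_param D' \in params m /\
  skew_brace_isomorphic (model D) (model D').
Proof.
have reflx : skew_brace_isomorphic (model D) (model D).
  by exists id; split=> //; exists id.
have k2 := refl_unit_sqr D.
have [tD|tD] := boolP (interchanged D).
  exists D; split=> //; rewrite /params /dihedral_params !inE.
  rewrite (negbTE (interchanged_even tD)).
  rewrite /datum_param tD (interchanged_rot_unit tD) imset_f ?orbT //.
  by rewrite inE; apply/eqP.
have p1 : rot_unit D = 1%R -> datum_param D \in params m.
  move=> p1; rewrite /params /cyclic_params !inE /datum_param (negbTE tD) p1.
  by rewrite imset_f // inE; apply/eqP.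
have [/rot_unit_odd/p1|odn] := boolP (odd n); first by exists D.
have [j jp] := rot_unit_gen tD.
case: (unit_rot_cases odn (rot_unit_sqr D) jp) => [/p1|[n8 pE]].
  by exists D.
have in_twisted D' : interchanged D' = false ->
    rot_unit D' = (1 + half)%R -> refl_unit D' < n./2 ->
    datum_param D' \in params m.
  move=> tD' pD' kD'.
  rewrite /params /twisted_params !inE n8 /datum_param tD' pD'.
  by rewrite imset_f ?orbT //= !inE kD' andbT; apply/eqP/refl_unit_sqr.
have [kl|kl] := boolP (refl_unit D < n./2).
  by exists D; split=> //; apply: in_twisted => //; apply: negbTE.
have kp2 : (rot_unit D * refl_unit D * (rot_unit D * refl_unit D) = 1)%R.
  have := rot_unit_sqr D => p2; ring: p2 k2.
pose D' := Datum (rot_unit_sqr D) kp2 (@interchanged_rot_unit _ D)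
  (@rot_unit_odd _ D) (@interchanged_even _ D) (@rot_unit_gen _ D).
exists D'; split.
  by apply: in_twisted => //=; [exact: negbTE | rewrite pE twist_low].
apply: model_twist => //=.
by rewrite mulrA rot_unit_sqr mul1r.
Qed.

Lemma params_inj D D' :
    datum_param D \in params m -> datum_param D' \in params m ->
  skew_brace_isomorphic (model D) (model D') -> datum_param D = datum_param D'.
Proof.
move=> PD PD' /model_iso_inv[tE pE kE].
rewrite /datum_param -tE -pE; congr (_, _).
case: kE => [//|[tD kE]].
have low D0 : datum_param D0 \in params m -> ~~ interchanged D0 ->
    rot_unit D0 = 1%R \/
    [/\ 8 %| n, rot_unit D0 = (1 + half)%R & refl_unit D0 < n./2].
  rewrite /params /twisted_params /dihedral_params !inE /datum_param.
  move=> P0 t0; move: P0; rewrite (negbTE t0).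
  case/orP=> [/orP[/imsetP[k _ [-> _]]|]|]; first by left.
    case: ifP => [n8|]; last by rewrite inE.
    by case/imsetP=> k; rewrite !inE => /andP[_ kl] [-> ->]; right.
  by case: ifP => _; rewrite ?inE // => /imsetP[k _ []].
case: (low D PD tD) => [p1|[n8 p1 kl]]; first by rewrite kE p1 mul1r.
have tD' : ~~ interchanged D' by rewrite -tE.
case: (low D' PD' tD') => [p1'|[_ _ kl']]; first by rewrite kE pE p1' mul1r.
by move: kl; rewrite kE p1 twist_low ?refl_unit_sqr // kl'.
Qed.

Lemma card_low_sqrt1 : 8 %| n -> #|sqrt1 m| = (2 * #|low_sqrt1 m|)%N.
Proof.
move=> n8; have p2 := twist_sqr n8; set p := (1 + half)%R in p2.
have pK : involutive (fun k => p * k)%R by move=> k /=; rewrite mulrA p2 mul1r.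
rewrite -(cardsID (low_sqrt1 m) (sqrt1 m)) mul2n -addnn.
have -> : sqrt1 m :&: low_sqrt1 m = low_sqrt1 m.
  by apply/setIidPr/subsetP => k; rewrite inE => /andP[].
congr (_ + _)%N; rewrite -(card_imset (low_sqrt1 m) (inv_inj pK)).
congr #|pred_of_set _|; apply/setP=> k; apply/idP/imsetP.
  rewrite !inE => /andP[kl /eqP k2]; rewrite k2 eqxx /= in kl.
  exists (p * k)%R; last by rewrite pK.
  by rewrite !inE twist_low // kl andbT; apply/eqP; ring: p2 k2.
case=> k'; rewrite !inE => /andP[/eqP k2 kl] ->.
rewrite twist_low // kl andbF /=; apply/eqP; ring: p2 k2.
Qed.

Lemma num_iso_classes_params : num_iso_classes (bidihedral n) #|params m|.
Proof.
have [f fE] := fin_all_exists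
  (fun i : 'I_#|params m| => datum_of_param (enum_valP i)).
exists (fun i => model (f i) : finSkewBraceType).
split=> [i|i j|G /bidihedral_complete].
- by split; [apply: dihedral_model | apply: dihedral_circ_model].
- move/params_inj; rewrite !fE => /(_ (enum_valP i) (enum_valP j)).
  exact: enum_val_inj.
case=> D iso; have [D' [PD' iso']] := param_of_datum D.
exists (enum_rank_in PD' (datum_param D')).
have E : datum_param (f (enum_rank_in PD' (datum_param D'))) = datum_param D'.
  by rewrite fE enum_rankK_in.
apply: skew_brace_isomorphic_trans iso _.
apply: skew_brace_isomorphic_trans iso' _.
exact: model_param_iso.
Qed.

End Params.

Local Open Scope ring_scope.

(* For n = 2 the formula fails: it gives 2, while the only bidihedral skew
   brace of order 4 up to isomorphism is the trivial one. *)
Theorem theorem1p1 (n : nat) (n_gt0 : (0 < n)%N) (n_neq2 : n <> 2%N) :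
  exists BD : nat,
    [/\ num_iso_classes (bidihedral n) BD,
        (n %% 8 \in [:: 1; 3; 5; 7])%N -> BD = #|K n|,
        (n %% 8 \in [:: 2; 4; 6])%N -> BD = (2 * #|K n|)%N
      & (n %% 8 = 0)%N -> BD%:R = (5%:R / 2%:R) * #|K n|%:R :> rat].
Proof.
case: n n_gt0 n_neq2 => [|[|[|m]]] // _ _.
  exists 1%N; split=> //; first exact: num_iso_classes_order2.
  move=> _; apply/esym/eqP/cards1P; exists ord0.
  by apply/setP=> k; rewrite !inE [k]ord1.
exists #|params m|; split; first exact: num_iso_classes_params.
- rewrite !inE card_params sqrt1E => n8.
  have -> : (8 %| m.+3)%N = false by lia.
  have -> : odd m.+3 by lia.
  by rewrite !addn0.
- rewrite !inE card_params sqrt1E => n8.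
  have -> : (8 %| m.+3)%N = false by lia.
  have -> : odd m.+3 = false by lia.
  by rewrite addn0 mul2n addnn.
rewrite card_params sqrt1E => n8.
have d8 : (8 %| m.+3)%N by rewrite /dvdn n8.
have -> : odd m.+3 = false by lia.
rewrite d8 (card_low_sqrt1 d8); set l := #|_|.
rewrite (_ : (2 * l + l + 2 * l)%N = (5 * l)%N); last by lia.
by rewrite !natrM; field.
Qed.
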